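(* Let $G$ be an input graph and let $H$ be any normal form of $G$ with respect to $\mathcal{R}=\{r_0,r_1,r_2\}$ (i.e. $G\Rightarrow_{\mathcal{R}}^*H$ and no rule of $\mathcal{R}$ is applicable to $H$). Then $H$ is the graph consisting of a single root node labelled $\square$ and no edges if and only if the underlying directed graph of $G$ is a tree. Moreover, for input graphs of bounded degree, a normal form is reached (the procedure terminates) in time linear in $|V_G|$.
   Context: Label alphabet $\mathcal{L}=(\{\square,\triangle\},\{\square\})$. A graph is $G=(V,E,s,t,l,m,p)$ with finite $V,E$, total $s,t:E\to V$, partial node labelling $l:V\to\{\square,\triangle\}$, total edge labelling $m:E\to\{\square\}$, partial rootedness $p:V\to\{0,1\}$ ($1$: root node). A TLRG has $l,p$ total. Morphisms preserve sources, targets, edge labels, and node labels and rootedness where defined in the domain. A rule $\langle L\leftarrow K\rightarrow R\rangle$: TLRGs $L,R$ and a graph $K$ that is a subgraph of both. Application to a TLRG $G$ via injective $g:L\to G$ satisfying the dangling condition (no edge outside $g(L)$ incident to a node of $g(V_L\setminus V_K)$): delete images of $L\setminus K$; make $g_V(v)$ unlabelled / of undefined rootedness when $v\in V_K$ is so in $K$; add disjointly $R\setminus K$ with labels/rootedness; give such $g_V(v)$ label $l_R(v)$ / rootedness $p_R(v)$. Rules (all edges labelled $\square$): $r_0$: $L$ has an unrooted node 1 labelled $\square$ with an edge to a rooted node 2 labelled $\square$; $K$ is node 1 alone, unlabelled and of undefined rootedness; $R$ is node 1, rooted, labelled $\square$. $r_1$: as $r_0$ but node 1 of $L$ is labelled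 $\triangle$. $r_2$: $L$ has a rooted node 1 labelled $\square$ with an edge to an unrooted node 2 labelled $\square$; $K$ consists of nodes 1,2, unlabelled and of undefined rootedness, no edges; $R$ has an unrooted node 1 labelled $\triangle$ with an edge to a rooted node 2 labelled $\square$. An input graph is a TLRG with exactly one root node in which all nodes and edges are labelled $\square$. A tree is a non-empty graph whose underlying undirected multigraph is connected and has no cycles (including no loops or parallel edges), and in which every node has at most one incoming edge. Computational model: graphs stored so that label-indexed node sets, degrees, neighbour counts/sets by label, $|V|,|E|$, rootedness of a node (O(1)) and the set of root nodes are accessible in time proportional to output size (constant for counts). Bounded degree: node degrees bounded by a fixed constant. *)

(* Defs.v *)
From HB Require Import structures.
From mathcomp Require Import all_boot finmap.

Set Implicit Arguments.
Unset Strict Implicit.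
Unset Printing Implicit Defensive.

Open Scope fset_scope.

Inductive node_label := Square | Triangle.

Inductive edge_label := ESquare.

Definition bool_of_node_label a := if a is Square then true else false.
Definition node_label_of_bool b := if b then Square else Triangle.
Lemma bool_of_node_labelK : cancel bool_of_node_label node_label_of_bool.
Proof. by case. Qed.
HB.instance Definition _ :=
  Equality.copy node_label (can_type bool_of_node_labelK).

Lemma unit_of_edge_labelK : cancel (fun _ : edge_label => tt) (fun=> ESquare).
Proof. by case. Qed.
HB.instance Definition _ :=
  Equality.copy edge_label (can_type unit_of_edge_labelK).

(* Nodes and edges are drawn from the universe [nat], so that every finite  *)
(* graph is represented up to isomorphism and inclusions [K <= L] are        *)
(* literal.  The functions [src], [tgt], [nlab], [elab], [rtd] matter only  *)
(* on the finite sets [nodes] and [edges]; their values elsewhere are junk, *)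
(* ignored by every notion below.                                           *)
(* [nlab] and [rtd] are partial ([None] = undefined); [rtd v = Some true]   *)
(* means that [v] is a root node.                                           *)
Record graph := Graph {
  nodes : {fset nat};
  edges : {fset nat};
  src : nat -> nat;
  tgt : nat -> nat;
  nlab : nat -> option node_label;
  elab : nat -> edge_label;
  rtd : nat -> option bool
}.

Definition wf_graph (G : graph) : Prop :=
  forall e, e \in edges G -> src G e \in nodes G /\ tgt G e \in nodes G.

(* totally labelled, rooted graph *)
Definition tlrg (G : graph) : Prop :=
  wf_graph G /\
  forall v, v \in nodes G -> nlab G v <> None /\ rtd G v <> None.

(* A pair of functions on identifiers, used for graph morphisms: the first  *)
(* component acts on nodes, the second one on edges.                        *)
Definition gmap : Type := (nat -> nat) * (nat -> nat).

Record morphism (G H : graph) (f : gmap) : Prop := Morphism {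
  mor_node : forall v, v \in nodes G -> f.1 v \in nodes H;
  mor_edge : forall e, e \in edges G -> f.2 e \in edges H;
  mor_src : forall e, e \in edges G -> src H (f.2 e) = f.1 (src G e);
  mor_tgt : forall e, e \in edges G -> tgt H (f.2 e) = f.1 (tgt G e);
  mor_elab : forall e, e \in edges G -> elab H (f.2 e) = elab G e;
  mor_nlab : forall v a, v \in nodes G ->
    nlab G v = Some a -> nlab H (f.1 v) = Some a;
  mor_rtd : forall v b, v \in nodes G ->
    rtd G v = Some b -> rtd H (f.1 v) = Some b
}.

Definition injective_gmap (G : graph) (f : gmap) : Prop :=
  {in nodes G &, injective f.1} /\ {in edges G &, injective f.2}.

Definition iso (G H : graph) : Prop :=
  exists f f' : gmap,
    [/\ morphism G H f, morphism H G f',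
        {in nodes G, cancel f.1 f'.1} /\ {in edges G, cancel f.2 f'.2}
      & {in nodes H, cancel f'.1 f.1} /\ {in edges H, cancel f'.2 f.2}].

Definition subgraph (K L : graph) : Prop :=
  [/\ wf_graph K, nodes K `<=` nodes L, edges K `<=` edges L
    & morphism K L (id, id)].

Record rule := Rule {
  lhs : graph;
  itf : graph;
  rhs : graph;
  lhs_tlrg : tlrg lhs;
  rhs_tlrg : tlrg rhs;
  itf_lhs : subgraph itf lhs;
  itf_rhs : subgraph itf rhs
}.

Definition deleted_nodes (r : rule) (g : gmap) : {fset nat} :=
  [fset g.1 x | x in nodes (lhs r) `\` nodes (itf r)].

Definition deleted_edges (r : rule) (g : gmap) : {fset nat} :=
  [fset g.2 x | x in edges (lhs r) `\` edges (itf r)].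

Definition dangling_condition (r : rule) (G : graph) (g : gmap) : Prop :=
  forall e, e \in edges G ->
    e \notin [fset g.2 x | x in edges (lhs r)] ->
    src G e \notin deleted_nodes r g /\ tgt G e \notin deleted_nodes r g.

Definition match_of (r : rule) (G : graph) (g : gmap) : Prop :=
  [/\ morphism (lhs r) G g, injective_gmap (lhs r) g
    & dangling_condition r G g].

(* the graph left once [L \ K] is deleted and the labels and rootedness     *)
(* undefined in [K] are erased                                              *)
Definition residual (r : rule) (G : graph) (g : gmap) : graph :=
  {| nodes := nodes G `\` deleted_nodes r g;
     edges := edges G `\` deleted_edges r g;
     src := src G;
     tgt := tgt G;
     nlab := fun v =>
       if v \in [fset g.1 x | x in nodes (itf r) & nlab (itf r) x == None]
       then None else nlab G v;
     elab := elab G;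
     rtd := fun v =>
       if v \in [fset g.1 x | x in nodes (itf r) & rtd (itf r) x == None]
       then None else rtd G v |}.

(* [H] is obtained from the residual graph [D] by adding [R \ K] disjointly *)
(* along [h : R -> H], which extends [g] on [K], and by giving the erased   *)
(* labels and rootedness their values in [R].                               *)
Record glued (r : rule) (D : graph) (g h : gmap) (H : graph) : Prop := Glued {
  glued_itf : {in nodes (itf r), h.1 =1 g.1} /\ {in edges (itf r), h.2 =1 g.2};
  glued_inj :
    {in nodes (rhs r) `\` nodes (itf r) &, injective h.1} /\
    {in edges (rhs r) `\` edges (itf r) &, injective h.2};
  glued_fresh :
    (forall x, x \in nodes (rhs r) `\` nodes (itf r) -> h.1 x \notin nodes D) /\
    (forall x, x \in edges (rhs r) `\` edges (itf r) -> h.2 x \notin edges D);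
  glued_nodes : nodes H =
    nodes D `|` [fset h.1 x | x in nodes (rhs r) `\` nodes (itf r)];
  glued_edges : edges H =
    edges D `|` [fset h.2 x | x in edges (rhs r) `\` edges (itf r)];
  glued_old_edge : forall e, e \in edges D ->
    [/\ src H e = src D e, tgt H e = tgt D e & elab H e = elab D e];
  glued_new_edge : forall e, e \in edges (rhs r) `\` edges (itf r) ->
    [/\ src H (h.2 e) = h.1 (src (rhs r) e),
        tgt H (h.2 e) = h.1 (tgt (rhs r) e)
      & elab H (h.2 e) = elab (rhs r) e];
  glued_old_node : forall v, v \in nodes D ->
    (nlab D v <> None -> nlab H v = nlab D v) /\
    (rtd D v <> None -> rtd H v = rtd D v);
  glued_itf_node : forall x, x \in nodes (itf r) ->
    (nlab (itf r) x = None -> nlab H (g.1 x) = nlab (rhs r) x) /\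
    (rtd (itf r) x = None -> rtd H (g.1 x) = rtd (rhs r) x);
  glued_new_node : forall x, x \in nodes (rhs r) `\` nodes (itf r) ->
    nlab H (h.1 x) = nlab (rhs r) x /\ rtd H (h.1 x) = rtd (rhs r) x
}.

(* direct derivation from a TLRG, closed under isomorphism of the result    *)
Definition applies (r : rule) (G H : graph) : Prop :=
  tlrg G /\
  exists g h X, [/\ match_of r G g, glued r (residual r G g) g h X & iso X H].

Definition applicable (r : rule) (G : graph) : Prop := exists g, match_of r G g.

Definition step (R : rule -> Prop) (G H : graph) : Prop :=
  exists2 r, R r & applies r G H.

Inductive derives (R : rule -> Prop) (G : graph) : graph -> Prop :=
| derives_iso H : iso G H -> derives R G H
| derives_step X H : step R G X -> derives R X H -> derives R G H.

Definition irreducible (R : rule -> Prop) (H : graph) : Prop :=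
  forall r, R r -> ~ applicable r H.

Definition normal_form (R : rule -> Prop) (G H : graph) : Prop :=
  derives R G H /\ irreducible R H.

Definition edge_1_2 (a1 a2 : node_label) (b1 b2 : bool) : graph :=
  {| nodes := [fset 1; 2]; edges := [fset 1];
     src := fun=> 1; tgt := fun=> 2;
     nlab := fun v => Some (if v == 1 then a1 else a2);
     elab := fun=> ESquare;
     rtd := fun v => Some (if v == 1 then b1 else b2) |}.

Definition discrete (V : {fset nat}) (a : option node_label) (b : option bool) :
    graph :=
  {| nodes := V; edges := fset0; src := id; tgt := id;
     nlab := fun=> a; elab := fun=> ESquare; rtd := fun=> b |}.

Lemma edge_1_2_tlrg a1 a2 b1 b2 : tlrg (edge_1_2 a1 a2 b1 b2).
Proof. by split=> // e _; rewrite /= !inE. Qed.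

Lemma discrete_tlrg V a b : tlrg (discrete V (Some a) (Some b)).
Proof. by split=> // e; rewrite /= inE. Qed.

Lemma discrete_subgraph (V : {fset nat}) (L : graph) :
  V `<=` nodes L -> subgraph (discrete V None None) L.
Proof.
move=> sVL; split=> //.
by split=> //= v /(fsubsetP sVL).
Qed.

Lemma fsub1_12 : [fset 1] `<=` [fset 1; 2].
Proof. by rewrite fsub1set !inE. Qed.

Definition prune_rule (a : node_label) : rule :=
  {| lhs := edge_1_2 a Square false true;
     itf := discrete [fset 1] None None;
     rhs := discrete [fset 1] (Some Square) (Some true);
     lhs_tlrg := edge_1_2_tlrg _ _ _ _;
     rhs_tlrg := discrete_tlrg _ _ _;
     itf_lhs := discrete_subgraph (L := edge_1_2 _ _ _ _) fsub1_12;
     itf_rhs := discrete_subgraph (L := discrete _ _ _) (fsubset_refl _) |}.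

Definition r0 : rule := prune_rule Square.
Definition r1 : rule := prune_rule Triangle.

Definition r2 : rule :=
  {| lhs := edge_1_2 Square Square true false;
     itf := discrete [fset 1; 2] None None;
     rhs := edge_1_2 Triangle Square false true;
     lhs_tlrg := edge_1_2_tlrg _ _ _ _;
     rhs_tlrg := edge_1_2_tlrg _ _ _ _;
     itf_lhs := discrete_subgraph (L := edge_1_2 _ _ _ _) (fsubset_refl _);
     itf_rhs := discrete_subgraph (L := edge_1_2 _ _ _ _) (fsubset_refl _) |}.

Definition tree_rules (r : rule) : Prop := [\/ r = r0, r = r1 | r = r2].

Definition input_graph (G : graph) : Prop :=
  [/\ tlrg G,
      #|` [fset v in nodes G | rtd G v == Some true]| = 1,
      forall v, v \in nodes G -> nlab G v = Some Square
    & forall e, e \in edges G -> elab G e = ESquare].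

Definition single_square_root (H : graph) : Prop :=
  edges H = fset0 /\
  exists v, [/\ nodes H = [fset v], nlab H v = Some Square
              & rtd H v = Some true].

(* A dart [(e, b)] is an edge together with a direction of traversal: along *)
(* [e] if [b], against [e] otherwise.                                       *)
Definition dart_start (G : graph) (d : nat * bool) : nat :=
  if d.2 then src G d.1 else tgt G d.1.
Definition dart_end (G : graph) (d : nat * bool) : nat :=
  if d.2 then tgt G d.1 else src G d.1.

Fixpoint walk (G : graph) (u : nat) (p : seq (nat * bool)) (v : nat) : Prop :=
  if p is d :: p' then
    [/\ d.1 \in edges G, dart_start G d = u & walk G (dart_end G d) p' v]
  else u = v.

Definition connected (G : graph) : Prop :=
  forall u v, u \in nodes G -> v \in nodes G -> exists p, walk G u p v.

(* A loop is a cycle of length 1, two parallel edges (of any orientation)   *)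
(* form a cycle of length 2.                                                *)
Definition cyc (G : graph) (p : seq (nat * bool)) : Prop :=
  [/\ p <> [::], exists v, walk G v p v,
      uniq [seq d.1 | d <- p] & uniq [seq dart_start G d | d <- p]].

Definition indegree (G : graph) (v : nat) : nat :=
  #|` [fset e in edges G | tgt G e == v]|.
Definition outdegree (G : graph) (v : nat) : nat :=
  #|` [fset e in edges G | src G e == v]|.
Definition degree (G : graph) (v : nat) : nat := indegree G v + outdegree G v.

Definition tree (G : graph) : Prop :=
  [/\ nodes G <> fset0, connected G, forall p, ~ cyc G p
    & forall v, v \in nodes G -> indegree G v <= 1].

Definition degree_bounded (d : nat) (G : graph) : Prop :=
  forall v, v \in nodes G -> degree G v <= d.

(* Programs act on a stored graph and have finitely many registers, each    *)
(* holding a reference to a node or an edge, and finitely many lists of     *)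
(* references.  Every elementary action costs one unit, except that         *)
(* retrieving a set costs one unit plus one per element.  No computation is *)
(* free, and references can only be moved around and compared.              *)

Inductive set_query :=
| NodesLabelled of node_label
| RootNodes
| OutEdges of nat & edge_label
| InEdges of nat & edge_label
| OutNeighbours of nat & node_label
| InNeighbours of nat & node_label.

Inductive count_query :=
| NodeCount
| EdgeCount
| Degree of nat
| InDegree of nat
| OutDegree of nat
| Card of set_query.

Inductive test :=
| IsEmpty of nat
| SameRef of nat & nat
| IsRoot of nat
| HasLabel of nat & node_label
| CountLeq of count_query & nat
| Not of test.

(* The natural numbers in commands are names of registers, except for the   *)
(* constant in [CountLeq].                                                  *)
Inductive cmd :=
| Seq of cmd & cmd
| If of test & cmd & cmd
| While of test & cmd
| Skip
| Copy of nat & nat             (* [Copy x y]: x receives register y       *)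
| Push of nat & nat             (* [Push l x]: push register x on list l   *)
| Pop of nat & nat              (* [Pop l x]: pop the head of l into x     *)
| Clear of nat
| Source of nat & nat           (* [Source x e]: x receives the source     *)
| Target of nat & nat
| Fetch of nat & set_query      (* store the answer to the query in a list *)
| AddNode of nat & node_label & bool
| DelNode of nat
| AddEdge of nat & nat & nat & edge_label   (* new edge, source, target    *)
| DelEdge of nat
| SetLabel of nat & node_label
| SetRoot of nat & bool.

Record state := State {
  store : graph;
  reg : nat -> option nat;
  lst : nat -> seq nat
}.

Definition init_state (G : graph) : state := State G (fun=> None) (fun=> [::]).

Definition set_store G s := State G (reg s) (lst s).
Definition set_reg x v s := State (store s) [eta reg s with x |-> Some v] (lst s).
Definition set_lst l vs s := State (store s) (reg s) [eta lst s with l |-> vs].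

(* [None] whenever the register does not refer to a node (edge) of the      *)
(* stored graph                                                             *)
Definition node_at (s : state) (x : nat) : option nat :=
  if reg s x is Some v then
    if v \in nodes (store s) then Some v else None
  else None.
Definition edge_at (s : state) (x : nat) : option nat :=
  if reg s x is Some e then
    if e \in edges (store s) then Some e else None
  else None.

Definition answer (s : state) (q : set_query) : option {fset nat} :=
  let G := store s in
  match q with
  | NodesLabelled a => Some [fset v in nodes G | nlab G v == Some a]
  | RootNodes => Some [fset v in nodes G | rtd G v == Some true]
  | OutEdges x m => omap (fun v =>
      [fset e in edges G | (src G e == v) && (elab G e == m)]) (node_at s x)
  | InEdges x m => omap (fun v =>
      [fset e in edges G | (tgt G e == v) && (elab G e == m)]) (node_at s x)
  | OutNeighbours x a => omap (fun v =>
      [fset w in [fset tgt G e | e in edges G & src G e == v]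
        | nlab G w == Some a]) (node_at s x)
  | InNeighbours x a => omap (fun v =>
      [fset w in [fset src G e | e in edges G & tgt G e == v]
        | nlab G w == Some a]) (node_at s x)
  end.

Definition answer_count (s : state) (q : count_query) : option nat :=
  let G := store s in
  match q with
  | NodeCount => Some #|` nodes G|
  | EdgeCount => Some #|` edges G|
  | Degree x => omap (degree G) (node_at s x)
  | InDegree x => omap (indegree G) (node_at s x)
  | OutDegree x => omap (outdegree G) (node_at s x)
  | Card q' => omap (fun A : {fset nat} => #|` A|) (answer s q')
  end.

Fixpoint eval (s : state) (t : test) : option bool :=
  match t with
  | IsEmpty l => Some (nilp (lst s l))
  | SameRef x y =>
      if (reg s x, reg s y) is (Some u, Some v) then Some (u == v) else None
  | IsRoot x => omap (fun v => rtd (store s) v == Some true) (node_at s x)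
  | HasLabel x a => omap (fun v => nlab (store s) v == Some a) (node_at s x)
  | CountLeq q k => omap (fun n => n <= k) (answer_count s q)
  | Not t' => omap negb (eval s t')
  end.

Definition add_node G v a b :=
  Graph (v |` nodes G) (edges G) (src G) (tgt G)
    [eta nlab G with v |-> Some a] (elab G) [eta rtd G with v |-> Some b].
Definition del_node G v :=
  Graph (nodes G `\ v) (edges G) (src G) (tgt G) (nlab G) (elab G) (rtd G).
Definition add_edge G e u v m :=
  Graph (nodes G) (e |` edges G) [eta src G with e |-> u]
    [eta tgt G with e |-> v] (nlab G) [eta elab G with e |-> m] (rtd G).
Definition del_edge G e :=
  Graph (nodes G) (edges G `\ e) (src G) (tgt G) (nlab G) (elab G) (rtd G).
Definition set_label G v a :=
  Graph (nodes G) (edges G) (src G) (tgt G)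
    [eta nlab G with v |-> Some a] (elab G) (rtd G).
Definition set_root G v b :=
  Graph (nodes G) (edges G) (src G) (tgt G)
    (nlab G) (elab G) [eta rtd G with v |-> Some b].

(* A configuration is a stack of commands still to be run and a state.  It  *)
(* is final if the stack is empty; a non-final configuration without        *)
(* successor is a run-time error (e.g. an undefined register, popping an    *)
(* empty list, deleting a node that has incident edges).                    *)
Definition config : Type := seq cmd * state.

(* [exec c n c']: [c] evolves to [c'] in one action, at cost [n].  The order *)
(* in which [Fetch] lists a set and the identity of new nodes and edges are *)
(* arbitrary.                                                               *)
Inductive exec : config -> nat -> config -> Prop :=
| exec_Seq c1 c2 k s : exec (Seq c1 c2 :: k, s) 1 ([:: c1, c2 & k], s)
| exec_If t c1 c2 k s b : eval s t = Some b ->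
    exec (If t c1 c2 :: k, s) 1 ((if b then c1 else c2) :: k, s)
| exec_While t c k s b : eval s t = Some b ->
    exec (While t c :: k, s) 1 (if b then [:: c, While t c & k] else k, s)
| exec_Skip k s : exec (Skip :: k, s) 1 (k, s)
| exec_Copy x y k s v : reg s y = Some v ->
    exec (Copy x y :: k, s) 1 (k, set_reg x v s)
| exec_Push l x k s v : reg s x = Some v ->
    exec (Push l x :: k, s) 1 (k, set_lst l (v :: lst s l) s)
| exec_Pop l x k s v vs : lst s l = v :: vs ->
    exec (Pop l x :: k, s) 1 (k, set_reg x v (set_lst l vs s))
| exec_Clear l k s : exec (Clear l :: k, s) 1 (k, set_lst l [::] s)
| exec_Source x y k s e : edge_at s y = Some e ->
    exec (Source x y :: k, s) 1 (k, set_reg x (src (store s) e) s)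
| exec_Target x y k s e : edge_at s y = Some e ->
    exec (Target x y :: k, s) 1 (k, set_reg x (tgt (store s) e) s)
| exec_Fetch l q k s (A : {fset nat}) vs :
    answer s q = Some A -> uniq vs -> vs =i A ->
    exec (Fetch l q :: k, s) (size vs).+1 (k, set_lst l vs s)
| exec_AddNode x a b k s v : v \notin nodes (store s) ->
    exec (AddNode x a b :: k, s) 1
         (k, set_reg x v (set_store (add_node (store s) v a b) s))
| exec_DelNode x k s v : node_at s x = Some v -> degree (store s) v = 0 ->
    exec (DelNode x :: k, s) 1 (k, set_store (del_node (store s) v) s)
| exec_AddEdge x y z m k s e u v :
    e \notin edges (store s) -> node_at s y = Some u -> node_at s z = Some v ->
    exec (AddEdge x y z m :: k, s) 1
         (k, set_reg x e (set_store (add_edge (store s) e u v m) s))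
| exec_DelEdge x k s e : edge_at s x = Some e ->
    exec (DelEdge x :: k, s) 1 (k, set_store (del_edge (store s) e) s)
| exec_SetLabel x a k s v : node_at s x = Some v ->
    exec (SetLabel x a :: k, s) 1 (k, set_store (set_label (store s) v a) s)
| exec_SetRoot x b k s v : node_at s x = Some v ->
    exec (SetRoot x b :: k, s) 1 (k, set_store (set_root (store s) v b) s).

Inductive runs : config -> nat -> config -> Prop :=
| runs_refl c : runs c 0 c
| runs_step c n c' m c'' : exec c n c' -> runs c' m c'' -> runs c (n + m) c''.

(* Whatever the non-deterministic choices, running [P] from [s] costs at    *)
(* most [N], raises no error, and ends (every action costs at least 1) in a *)
(* state satisfying [Q].                                                    *)
Definition halts_within (P : cmd) (s : state) (N : nat) (Q : state -> Prop) :
    Prop :=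
  forall n k s', runs ([:: P], s) n (k, s') ->
    n <= N /\
    (if k is [::] then Q s' else exists m c, exec (k, s') m c).

(* List 0 serves as failure flag: it is empty as long as no attempt to      *)
(* apply a rule has failed.                                                 *)
Definition failed (s : state) : Prop := lst s 0 <> [::].

Definition returns (P : cmd) (s s' : state) : Prop :=
  exists n, runs ([:: P], s) n ([::], s').

(* On the stored graph, [P] performs one direct derivation with a rule of   *)
(* [R], or fails, leaving the graph as it is, if there is none; up to       *)
(* isomorphism, every direct derivation may be the one performed.           *)
Definition rewrites_once (R : rule -> Prop) (P : cmd) (s : state) : Prop :=
  (forall s', returns P s s' ->
     (~ failed s' /\ step R (store s) (store s')) \/
     [/\ failed s', irreducible R (store s) & iso (store s) (store s')]) /\
  (forall X, step R (store s) X ->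
     exists s', [/\ returns P s s', ~ failed s' & iso (store s') X]).

(* [P] implements one application of a rule of [R] in every state reachable *)
(* by rewriting an input graph, whatever the registers and the other lists  *)
(* contain.                                                                 *)
Definition implements_step (R : rule -> Prop) (P : cmd) : Prop :=
  forall G s, input_graph G -> derives R G (store s) -> ~ failed s ->
    rewrites_once R P s.

Definition as_long_as_possible (P : cmd) : cmd := While (IsEmpty 0) P.

(* Main.v *)
Require Import Defs.
From mathcomp Require Import all_boot finmap.
From mathcomp Require Import zify.
From Stdlib Require Import FunctionalExtensionality.

(* Rules r0 and r1 remove a leaf holding the root token and move the token    *)
(* to its parent, which preserves and reflects being a tree; rule r2 keeps    *)
(* the underlying graph.  In a tree, the nodes labelled Triangle stay         *)
(* ancestors of the root node: if no rule applies, the root node has no child *)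
(* (a Triangle child would close a cycle, a Square one would enable r2),      *)
(* hence is a leaf without parent (otherwise r0 or r1 applies), and the graph *)
(* is a single node.                                                          *)
(* For the time bound, the number of nodes plus the number of nodes labelled  *)
(* Square decreases with every derivation, since r0 and r1 delete a node and  *)
(* r2 loses a Square.  Only the root node and its neighbourhood have to be    *)
(* inspected, at a cost bounded in terms of the degree.                       *)

Set Implicit Arguments.
Unset Strict Implicit.
Unset Printing Implicit Defensive.

Local Open Scope fset_scope.

(** * Isomorphisms and direct derivations *)

(** Up to isomorphism, a derivation is one of two explicit edits ([step_treeP]): [pruned] deletes a
    rooted leaf and roots its parent, [moved] only changes labels and rootedness. Removing a pendant
    edge together with its leaf neither creates nor destroys a tree ([tree_pruned]), so being a tree
    is transferred both ways along derivations ([derives_tree]); as a single node is a tree, one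
    implication follows. For the converse, the invariant [trail] says that each [Triangle] node has
    an edge to a [Triangle] node or to the root. If no rule applies, a child of the root can only be
    a [Triangle]; then every node that is a [Triangle] or the root has a successor of the same kind,
    and a finite graph contains a directed cycle ([successors_cyc]). So the root has no child, hence
    no parent either, and connectedness leaves nothing else ([irreducible_tree]).

    For the running time, pruning and moving exclude each other: a prunable root has one edge, an
    incoming one, while a movable root has an outgoing edge. Two degree tests therefore select the
    rule ([rewrite_cmd]), and one round costs a constant plus the degree bound. The strictly
    decreasing [potential] is at most twice the number of nodes, which makes the loop linear
    ([loop_safe]). The [safe] lemmas concern all runs; the [reaches] lemmas show that each
    derivation can be the one performed. *)

Lemma iso_refl G : iso G G.
Proof. by exists (id, id), (id, id); split; split. Qed.

Lemma iso_sym G H : iso G H -> iso H G.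
Proof. by move=> [f [f' [? ? ? ?]]]; exists f', f. Qed.

Lemma morphism_comp G H K f f' : morphism G H f -> morphism H K f' ->
  morphism G K (f'.1 \o f.1, f'.2 \o f.2).
Proof.
move=> [a1 a2 a3 a4 a5 a6 a7] [b1 b2 b3 b4 b5 b6 b7].
split=> /=.
- by move=> v /a1/b1.
- by move=> v /a2/b2.
- by move=> e He; rewrite b3 ?a2 ?a3.
- by move=> e He; rewrite b4 ?a2 ?a4.
- by move=> e He; rewrite b5 ?a2 ?a5.
- by move=> v a Hv /a6 E; apply: b6 (a1 _ Hv) (E Hv).
- by move=> v a Hv /a7 E; apply: b7 (a1 _ Hv) (E Hv).
Qed.

Lemma iso_trans G H K : iso G H -> iso H K -> iso G K.
Proof.
move=> [f [f' [Mf Mf' [f1 f2] [f1' f2']]]] [g [g' [Mg Mg' [g1 g2] [g1' g2']]]].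
exists (g.1 \o f.1, g.2 \o f.2), (f'.1 \o g'.1, f'.2 \o g'.2); split.
- exact: morphism_comp Mf Mg.
- exact: morphism_comp Mg' Mf'.
- by split=> x Hx /=; rewrite ?g1 ?g2 ?f1 ?f2 ?(mor_node Mf) ?(mor_edge Mf).
- by split=> x Hx /=; rewrite ?f1' ?f2' ?g1' ?g2' ?(mor_node Mg') ?(mor_edge Mg').
Qed.

(** Nodes are kept and only edges are renamed: this is the freedom that [r2] has when it replaces an
    edge by a new one. Edge labels agree because [edge_label] has a single value. *)
Lemma iso_same_nodes G H (f f' : nat -> nat) :
  nodes H = nodes G ->
  {in nodes G, nlab H =1 nlab G} -> {in nodes G, rtd H =1 rtd G} ->
  {in edges G, cancel f f'} -> {in edges H, cancel f' f} ->
  (forall e, e \in edges G ->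
     [/\ f e \in edges H, src H (f e) = src G e & tgt H (f e) = tgt G e]) ->
  (forall e, e \in edges H -> f' e \in edges G) ->
  iso G H.
Proof.
move=> eqV eql eqr fK f'K fE f'E.
have elabE (e1 e2 : edge_label) : e1 = e2 by case: e1; case: e2.
exists (id, f), (id, f'); split; [split|split| |] => //=.
- by move=> v; rewrite eqV.
- by move=> e /fE[].
- by move=> e /fE[].
- by move=> e /fE[].
- by move=> v a Hv; rewrite eql.
- by move=> v a Hv; rewrite eqr.
- by move=> v; rewrite eqV.
- by move=> e He; case: (fE _ (f'E _ He)) => _ <- _; rewrite f'K.
- by move=> e He; case: (fE _ (f'E _ He)) => _ _ <-; rewrite f'K.
- by move=> v a; rewrite eqV => Hv; rewrite eql.
- by move=> v a; rewrite eqV => Hv; rewrite eqr.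
Qed.

(** * Direct derivations as explicit edits *)

Definition pruned G e : graph :=
  set_root (set_label (del_node (del_edge G e) (tgt G e)) (src G e) Square)
    (src G e) true.

(** The edge that [r2] deletes and recreates is kept here, which changes the result only by a
    renaming of that edge. *)
Definition moved G v w : graph :=
  set_root (set_root (set_label G v Triangle) v false) w true.

(** A match of a pruning rule, reduced to the image of its edge: [src G e <> tgt G e] is injectivity
    on nodes, and the last clause is the dangling condition. *)
Definition prunable a G e : Prop :=
  [/\ e \in edges G, src G e <> tgt G e,
      nlab G (src G e) = Some a /\ nlab G (tgt G e) = Some Square,
      rtd G (src G e) = Some false /\ rtd G (tgt G e) = Some true
    & forall e', e' \in edges G -> e' <> e ->
        src G e' <> tgt G e /\ tgt G e' <> tgt G e].

Definition movable G v w : Prop :=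
  [/\ exists2 e, e \in edges G & src G e = v /\ tgt G e = w, v <> w,
      nlab G v = Some Square /\ nlab G w = Some Square
    & rtd G v = Some true /\ rtd G w = Some false].

Lemma imfset_fsetDv (f : nat -> nat) (A : {fset nat}) :
  [fset f x | x in A `\` A] = fset0.
Proof. by rewrite fsetDv; apply/fsetP=> x; apply/imfsetP=> -[]. Qed.

Lemma mem_deleted_nodes_prune a g x :
  (x \in deleted_nodes (prune_rule a) g) = (x == g.1 2).
Proof.
apply/imfsetP/eqP => [[y /=]|->]; last by exists 2; rewrite //= !inE.
by rewrite !inE => /andP[/negPf-> /= /eqP->].
Qed.

Lemma mem_deleted_edges_prune a g x :
  (x \in deleted_edges (prune_rule a) g) = (x == g.2 1).
Proof.
apply/imfsetP/eqP => [[y /=]|->]; last by exists 1; rewrite //= !inE.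
by rewrite !inE => /eqP->.
Qed.

Lemma mem_deleted_nodes_r2 g x : (x \in deleted_nodes r2 g) = false.
Proof. by apply/negP=> /imfsetP[y /=]; rewrite inE andNb. Qed.

Lemma mem_deleted_edges_r2 g x : (x \in deleted_edges r2 g) = (x == g.2 1).
Proof.
apply/imfsetP/eqP => [[y /=]|->]; last by exists 1; rewrite //= !inE.
by rewrite !inE => /eqP->.
Qed.

Lemma match_pruneP a G g : match_of (prune_rule a) G g ->
  [/\ prunable a G (g.2 1), src G (g.2 1) = g.1 1 & tgt G (g.2 1) = g.1 2].
Proof.
case=> M [injV _] D.
have E1 : 1 \in edges (edge_1_2 a Square false true) by rewrite inE.
have V1 : 1 \in nodes (edge_1_2 a Square false true) by rewrite !inE.
have V2 : 2 \in nodes (edge_1_2 a Square false true) by rewrite !inE.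
have Es := mor_src M E1; have Et := mor_tgt M E1; rewrite /= in Es Et.
split=> //; split.
- exact: (mor_edge M E1).
- by rewrite Es Et => /(injV _ _ V1 V2).
- by rewrite Es Et; split; [apply: (mor_nlab M V1)|apply: (mor_nlab M V2)].
- by rewrite Es Et; split; [apply: (mor_rtd M V1)|apply: (mor_rtd M V2)].
- move=> e' He' ne; rewrite Et.
  have /(D _ He')[] : e' \notin [fset g.2 x | x in edges (lhs (prune_rule a))].
    by apply/imfsetP=> -[x /=]; rewrite inE => /eqP-> /ne.
  by rewrite !mem_deleted_nodes_prune => /eqP ? /eqP ?.
Qed.

Lemma match_r2P G g : match_of r2 G g ->
  [/\ movable G (g.1 1) (g.1 2), g.2 1 \in edges G,
      src G (g.2 1) = g.1 1 & tgt G (g.2 1) = g.1 2].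
Proof.
case=> M [injV _] _.
have E1 : 1 \in edges (edge_1_2 Square Square true false) by rewrite inE.
have V1 : 1 \in nodes (edge_1_2 Square Square true false) by rewrite !inE.
have V2 : 2 \in nodes (edge_1_2 Square Square true false) by rewrite !inE.
have Es := mor_src M E1; have Et := mor_tgt M E1; rewrite /= in Es Et.
have Ee := mor_edge M E1.
split=> //; split.
- by exists (g.2 1).
- by move=> /(injV _ _ V1 V2).
- by split; [apply: (mor_nlab M V1)|apply: (mor_nlab M V2)].
- by split; [apply: (mor_rtd M V1)|apply: (mor_rtd M V2)].
Qed.

Lemma applies_pruneP a G H : applies (prune_rule a) G H ->
  exists2 e, prunable a G e & iso (pruned G e) H.
Proof.
move=> [[wfG tG] [g [h [X [M [_ _ _ gV gE gOE _ gOV gIV _] XH]]]]].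
have [P Es Et] := match_pruneP M.
exists (g.2 1) => //; apply: iso_trans XH.
move: P => [He ne [l1 l2] [p1 p2] D].
have VX : nodes X = nodes G `\ g.1 2.
  rewrite gV imfset_fsetDv fsetU0; apply/fsetP=> x.
  by rewrite !inE mem_deleted_nodes_prune.
have EX : edges X = edges G `\ g.2 1.
  rewrite gE imfset_fsetDv fsetU0; apply/fsetP=> x.
  by rewrite !inE mem_deleted_edges_prune.
have [] := gIV 1; rewrite /= ?inE // => /(_ erefl) nX /(_ erefl) rX.
(* Since [G] is total, labels and rootedness outside the interface stay defined in the residual
   graph, so gluing has to keep them. *)
have old w : w \in nodes G `\ g.1 2 -> w != g.1 1 ->
    nlab X w = nlab G w /\ rtd X w = rtd G w.
  move=> Hw neq; have Hw' := Hw; rewrite !inE in Hw'; case/andP: Hw' => ne2 wG.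
  have [n0 q0] := tG _ wG.
  have wD : w \in nodes (residual (prune_rule a) G g).
    by rewrite /= !inE mem_deleted_nodes_prune ne2.
  have := gOV _ wD; rewrite /=.
  have N1 : w \notin [fset g.1 x | x in [fset 1] & None == None :> option node_label].
    by apply/imfsetP=> -[y /=]; rewrite !inE andbT => /eqP-> /eqP; apply/negP.
  have N2 : w \notin [fset g.1 x | x in [fset 1] & None == None :> option bool].
    by apply/imfsetP=> -[y /=]; rewrite !inE andbT => /eqP-> /eqP; apply/negP.
  by rewrite (negPf N1) ?(negPf N2) => -[A B]; split; auto.
apply: (@iso_same_nodes _ _ id id) => //.
- by rewrite VX /= Et.
- move=> w; rewrite /= Et => Hw; rewrite Es; case: eqP => [->//|/eqP ne1].
  by case: (old _ Hw ne1).
- move=> w; rewrite /= Et => Hw; rewrite Es; case: eqP => [->//|/eqP ne1].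
  by case: (old _ Hw ne1).
- move=> e /= eE; rewrite EX; split=> //.
  + by case: (gOE e) => //=; rewrite !inE mem_deleted_edges_prune; move: eE; rewrite !inE.
  + by case: (gOE e) => //=; rewrite !inE mem_deleted_edges_prune; move: eE; rewrite !inE.
- by move=> e; rewrite EX.
Qed.

Lemma applies_r2P G H : applies r2 G H ->
  exists v w, movable G v w /\ iso (moved G v w) H.
Proof.
move=> [[wfG tG] [g [h [X [M [[gH _] _ [_ gF] gV gE gOE gNE gOV gIV _] XH]]]]].
have [P He Es Et] := match_r2P M.
exists (g.1 1), (g.1 2); split=> //; apply: iso_trans XH.
move: P => [_ ne [l1 l2] [p1 p2]].
have VX : nodes X = nodes G.
  rewrite gV imfset_fsetDv fsetU0; apply/fsetP=> x.
  by rewrite !inE mem_deleted_nodes_r2.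
have E1 : 1 \in edges (rhs r2) `\` edges (itf r2) by rewrite !inE.
have EX : edges X = h.2 1 |` (edges G `\ g.2 1).
  rewrite gE; apply/fsetP=> x; rewrite !inE mem_deleted_edges_r2 orbC.
  congr (_ || _); apply/imfsetP/eqP => [[y /=]|->]; last by exists 1.
  by rewrite !inE => /eqP->.
have eD e : e \in edges G -> e != g.2 1 -> e \in edges (residual r2 G g).
  by move=> eG ne1; rewrite /= !inE mem_deleted_edges_r2 ne1.
(* Freshness is relative to the residual graph, so [h.2 1] may be the deleted edge [g.2 1] itself;
   the renamings [f] and [f'] below allow for this. *)
have hF : h.2 1 \notin edges G `\ g.2 1.
  have := gF _ E1; rewrite /= !inE mem_deleted_edges_r2; exact.
have [nE1 nE2 _] := gNE _ E1; rewrite /= in nE1 nE2.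
have I1 : 1 \in nodes (itf r2) by rewrite !inE.
have I2 : 2 \in nodes (itf r2) by rewrite !inE.
rewrite !gH // in nE1 nE2.
have [/(_ erefl) nX1 /(_ erefl) rX1] := gIV _ I1.
have [/(_ erefl) nX2 /(_ erefl) rX2] := gIV _ I2.
have old w : w \in nodes G -> w != g.1 1 -> w != g.1 2 ->
    nlab X w = nlab G w /\ rtd X w = rtd G w.
  move=> wG ne1 ne2; have [n0 q0] := tG _ wG.
  have wD : w \in nodes (residual r2 G g) by rewrite /= inE mem_deleted_nodes_r2.
  have := gOV _ wD; rewrite /=.
  have N1 : w \notin [fset g.1 x | x in [fset 1; 2] & None == None :> option node_label].
    by apply/imfsetP=> -[y /=]; rewrite !inE andbT => /orP[]/eqP-> /eqP; apply/negP.
  have N2 : w \notin [fset g.1 x | x in [fset 1; 2] & None == None :> option bool].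
    by apply/imfsetP=> -[y /=]; rewrite !inE andbT => /orP[]/eqP-> /eqP; apply/negP.
  by rewrite (negPf N1) ?(negPf N2) => -[A B]; split; auto.
pose f e := if e == g.2 1 then h.2 1 else e.
pose f' e := if e == h.2 1 then g.2 1 else e.
apply: (@iso_same_nodes _ _ f f') => //.
- move=> w wG; rewrite /moved /=; case: (eqVneq w (g.1 1)) => [->//|ne1].
  case: (eqVneq w (g.1 2)) => [->|ne2]; first by rewrite nX2 l2.
  by case: (old _ wG ne1 ne2).
- move=> w wG; rewrite /moved /=; case: (eqVneq w (g.1 2)) => [->//|ne2].
  case: (eqVneq w (g.1 1)) => [->//|ne1].
  by case: (old _ wG ne1 ne2).
- move=> e /= eE; rewrite /f /f'; case: (eqVneq e (g.2 1)) => [->|ne1].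
    by rewrite eqxx.
  by case: eqP => // E; case/negP: hF; rewrite -E !inE ne1.
- move=> e; rewrite EX !inE /f /f'; case: (eqVneq e (h.2 1)) => [->|ne1].
    by rewrite eqxx.
  by case/andP=> /negPf->.
- move=> e /= eE; rewrite /f; case: (eqVneq e (g.2 1)) => [->|ne1].
    by rewrite EX !inE eqxx Es Et.
  rewrite EX !inE ne1 eE orbT; split=> //; by case: (gOE e (eD _ eE ne1)).
- move=> e; rewrite EX !inE /f'; case: (eqVneq e (h.2 1)) => [->//|_].
  by case/andP.
Qed.

Lemma prunable_applies a G e : tlrg G -> prunable a G e ->
  applies (prune_rule a) G (pruned G e).
Proof.
move=> tG [He ne [l1 l2] [p1 p2] D]; split=> //.
pose g : gmap := (fun x => if x == 1 then src G e else tgt G e, fun=> e).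
exists g, g, (pruned G e); split; last exact: iso_refl.
- split.
  + split=> //=.
    * by move=> v _; case: eqP => _; case: tG => wf _; case: (wf _ He).
    * by move=> e' _; case: (elab G e).
    * by move=> v b _ [<-]; case: eqP.
    * by move=> v b _ [<-]; case: eqP.
  + split=> /= x y; rewrite !inE; last by move=> /eqP-> /eqP->.
    by move=> /orP[]/eqP-> /orP[]/eqP-> //= /esym.
  + move=> e' He' /imfsetP ne'; rewrite !mem_deleted_nodes_prune /=.
    have [] := D e' He'; last by move=> /eqP? /eqP?.
    by move=> E; apply: ne'; exists 1; rewrite //= inE.
- split=> //.
  + by split=> x y; rewrite /= !inE ?andNb.
  + by split=> x; rewrite /= inE ?andNb // fsetDv.
  + rewrite imfset_fsetDv fsetU0; apply/fsetP=> x.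
  by rewrite !inE mem_deleted_nodes_prune.
  + rewrite imfset_fsetDv fsetU0; apply/fsetP=> x.
  by rewrite !inE mem_deleted_edges_prune.
  + by move=> e'; rewrite inE andNb.
  + move=> v /= Hv; split; case: ifP => // /imfsetP H; case: eqP => // E _;
    by case: H; exists 1; rewrite //= !inE.
  + by move=> x; rewrite inE => /eqP->; rewrite /= eqxx.
  + by move=> x; rewrite inE andNb.
Qed.

Lemma movable_applies G v w : tlrg G -> movable G v w ->
  applies r2 G (moved G v w).
Proof.
move=> tG [[e He [Es Et]] ne [l1 l2] [p1 p2]]; split=> //.
pose g : gmap := (fun x => if x == 1 then v else w, fun=> e).
have [Hv Hw] : v \in nodes G /\ w \in nodes G.
  by case: tG => wf _; case: (wf _ He); rewrite Es Et.
(* The new edge may reuse the identifier of the deleted one, so [g] serves as [h] too. *)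
exists g, g, (moved G v w); split; last exact: iso_refl.
- split.
  + split=> //=.
    * by move=> x _; case: eqP.
    * by move=> e' _; case: (elab G e).
    * by move=> x b _ [<-]; case: eqP.
    * by move=> x b _ [<-]; case: eqP.
  + split=> /= x y; rewrite !inE; last by move=> /eqP-> /eqP->.
    by move=> /orP[]/eqP-> /orP[]/eqP-> //= /esym.
  + by move=> e' He' _; rewrite !mem_deleted_nodes_r2.
- split=> //.
  + split=> x y; first by rewrite inE andNb.
    by rewrite !inE => /andP[_ /eqP E1] /andP[_ /eqP E2] _; rewrite E1 E2.
  + split=> x; rewrite inE ?andNb // => _.
    by rewrite inE mem_deleted_edges_r2 eqxx.
  + rewrite imfset_fsetDv fsetU0; apply/fsetP=> x.
  by rewrite !inE mem_deleted_nodes_r2.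
  + have -> : [fset g.2 x | x in edges (rhs r2) `\` edges (itf r2)] = [fset e].
      apply/fsetP=> x; rewrite inE.
      by apply/imfsetP/eqP=> [[y _ ->]|->] //; exists 1; rewrite //= !inE.
    apply/fsetP=> x; rewrite !inE mem_deleted_edges_r2 /=.
    by case: eqP => [->|_]; rewrite ?He ?orbF.
  + move=> e'; rewrite !inE => /eqP->; split=> //=; by case: (elab G e).
  + move=> x /= Hx; split; case: ifP => // /imfsetP H.
      case: eqP => // E _; by case: H; exists 1; rewrite //= !inE.
    case: eqP => [E|_]; first by case: H; exists 2; rewrite //= !inE.
    case: eqP => // E _; by case: H; exists 1; rewrite //= !inE.
  + move=> x; rewrite !inE => /orP[]/eqP-> /=; rewrite ?eqxx //.
      by case: eqP.
    by case: eqP => // E; rewrite E in ne.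
  + by move=> x; rewrite inE andNb.
Qed.

Lemma step_treeP G H : step tree_rules G H <->
  tlrg G /\ ((exists a e, prunable a G e /\ iso (pruned G e) H) \/
             (exists v w, movable G v w /\ iso (moved G v w) H)).
Proof.
split=> [[r Rr rGH]|[tG]].
  split; first by case: rGH.
  case: Rr rGH => -> => [/applies_pruneP[e]|/applies_pruneP[e]|/applies_r2P].
  - by left; exists Square, e.
  - by left; exists Triangle, e.
  - by right.
have closed r X : applies r G X -> iso X H -> applies r G H.
  by move=> [_ [g [h [Y [? ? YX]]]]] XH; split=> //; exists g, h, Y; split=> //;
     apply: iso_trans XH.
case=> [[a [e [pr isoH]]]|[v [w [mv isoH]]]].
  exists (prune_rule a); first by case: a {pr}; [constructor 1|constructor 2].
  exact: closed (prunable_applies tG pr) isoH.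
exists r2; first by constructor 3.
exact: closed (movable_applies tG mv) isoH.
Qed.

(** * The unique root node as an invariant *)

Definition rooted_at G v : Prop :=
  [/\ v \in nodes G, nlab G v = Some Square, rtd G v = Some true
    & forall w, w \in nodes G -> rtd G w = Some true -> w = v].

Definition well_rooted G : Prop := tlrg G /\ exists v, rooted_at G v.

Lemma input_well_rooted G : input_graph G -> well_rooted G.
Proof.
move=> [tG /eqP/cardfs1P[v E] sq _]; split=> //; exists v.
have inE' w : (w \in nodes G) && (rtd G w == Some true) = (w == v).
  by have /fsetP/(_ w) := E; rewrite !inE.
have := inE' v; rewrite eqxx => /andP[Hv /eqP Rv]; split=> //; first exact: sq.
by move=> w Hw Rw; apply/eqP; rewrite -inE' Hw Rw eqxx.
Qed.

Lemma iso_tlrg G H : iso G H -> tlrg G -> tlrg H.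
Proof.
move=> [f [f' [Mf Mf' _ [K1 K2]]]] [wf tot]; split.
  move=> e He; have He' := mor_edge Mf' He; case: (wf _ He') => s t.
  rewrite -(K2 _ He) (mor_src Mf He') (mor_tgt Mf He').
  by split; apply: (mor_node Mf).
move=> v Hv; have Hv' := mor_node Mf' Hv; have [] := tot _ Hv'.
case E: nlab => [a|] // _; case E': rtd => [b|] // _.
by rewrite -(K1 _ Hv) (mor_nlab Mf Hv' E) (mor_rtd Mf Hv' E').
Qed.

Lemma iso_well_rooted G H : iso G H -> well_rooted G -> well_rooted H.
Proof.
move=> GH [tG [v [Hv sq rv u]]]; split; first exact: iso_tlrg GH tG.
case: GH => [f [f' [Mf Mf' _ [K1 K2]]]]; exists (f.1 v); split.
- exact: (mor_node Mf).
- exact: (mor_nlab Mf).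
- exact: (mor_rtd Mf).
- move=> w Hw Rw; rewrite -(K1 _ Hw); congr f.1.
  by apply: u; [apply: (mor_node Mf')|apply: (mor_rtd Mf')].
Qed.

Lemma prunable_nodes a G e : tlrg G -> prunable a G e ->
  [/\ src G e \in nodes G, tgt G e \in nodes G & src G e \in nodes (pruned G e)].
Proof.
move=> [wf _] [He ne _ _ _]; case: (wf _ He) => s t; split=> //.
by rewrite !inE s; case: eqP ne.
Qed.

Lemma pruned_tlrg a G e : tlrg G -> prunable a G e -> tlrg (pruned G e).
Proof.
move=> [wf tot] [He ne _ _ D]; split=> /=.
  move=> e'; rewrite !inE => /andP[/eqP ne' He']; case: (wf _ He') => -> ->.
  by case: (D _ He' ne') => /eqP-> /eqP->.
by move=> v; rewrite !inE => /andP[_ /tot[]]; case: eqP.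
Qed.

Lemma pruned_well_rooted a G e : well_rooted G -> prunable a G e -> well_rooted (pruned G e).
Proof.
move=> [tG [v [Hv sq rv u]]] pr; split; first exact: pruned_tlrg tG pr.
have [s t s'] := prunable_nodes tG pr.
exists (src G e); split=> //=; rewrite ?eqxx //.
move=> w; rewrite !inE => /andP[ne Hw]; case: eqP => // _ Rw.
case: pr => _ _ _ [_ p] _; case/negP: ne; rewrite (u _ Hw Rw); apply/eqP.
by rewrite (u _ t p).
Qed.

Lemma movable_nodes G v w : tlrg G -> movable G v w ->
  v \in nodes G /\ w \in nodes G.
Proof. by move=> [wf _] [[e He [<- <-]] _ _ _]; apply: wf. Qed.

Lemma moved_tlrg G v w : tlrg G -> tlrg (moved G v w).
Proof.
move=> [wf tot]; split=> // x /tot[]; rewrite /moved /= => n r.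
by split; do ![case: eqP => // _].
Qed.

Lemma moved_well_rooted G v w : well_rooted G -> movable G v w -> well_rooted (moved G v w).
Proof.
move=> [tG [r [Hr sq rr u]]] mv; split; first exact: moved_tlrg.
have [Hv Hw] := movable_nodes tG mv; case: mv => _ ne [l1 l2] [p1 p2].
exists w; split=> //=; rewrite ?eqxx //; first by case: eqP ne => // ->.
move=> x Hx; case: eqP => // _; case: eqP => // nv Rx.
by case: nv; rewrite (u _ Hx Rx) (u _ Hv p1).
Qed.

Lemma step_well_rooted G H : well_rooted G -> step tree_rules G H -> well_rooted H.
Proof.
move=> pG /step_treeP[tG [[a [e [pr]]]|[v [w [mv]]]]] /iso_well_rooted; apply.
  exact: pruned_well_rooted pr.
exact: moved_well_rooted.
Qed.

Lemma derives_well_rooted G H : well_rooted G -> derives tree_rules G H -> well_rooted H.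
Proof.
move=> pG D; elim: D pG => [K L KL|K X L st _ IH]; first exact: iso_well_rooted.
by move/step_well_rooted/(_ st).
Qed.

(** * Trees *)

(** Labels and rootedness are ignored, so that isomorphisms, the inclusion of [pruned G e] in [G]
    and the identity between [G] and [moved G v w] are all instances. *)
Definition embedding G H (f : gmap) : Prop :=
  [/\ {in nodes G &, injective f.1}, {in edges G &, injective f.2}
    & forall e, e \in edges G -> [/\ f.2 e \in edges H,
        src H (f.2 e) = f.1 (src G e) & tgt H (f.2 e) = f.1 (tgt G e)]].

Lemma walk_nodes G u p v : wf_graph G -> walk G u p v ->
  forall d, d \in p -> [/\ d.1 \in edges G, dart_start G d \in nodes G
                         & dart_end G d \in nodes G].
Proof.
move=> wf; elim: p u => //= d p IH u [He _ W] d'; rewrite inE => /predU1P[->|].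
  by split=> //; case: (wf _ He); rewrite /dart_start /dart_end; case: (d.2).
exact: IH W _.
Qed.

Lemma walk_map G H f u p v : embedding G H f -> walk G u p v ->
  walk H (f.1 u) [seq (f.2 d.1, d.2) | d <- p] (f.1 v).
Proof.
move=> [_ _ E]; elim: p u => [u /= -> //|d p IH u [He <- /IH W]] /=.
have [He' s t] := E _ He; split=> //; rewrite /dart_start /= ?s ?t.
  by case: (d.2).
by move: W; rewrite /dart_end /= s t; case: (d.2).
Qed.

Lemma walk_cat G u p v q w : walk G u p v -> walk G v q w -> walk G u (p ++ q) w.
Proof.
elim: p u => [u /= -> //|d p IH u [He <- W] /(IH _ W) W']; by split.
Qed.

Lemma cyc_map G H f p : wf_graph G -> embedding G H f -> cyc G p ->
  cyc H [seq (f.2 d.1, d.2) | d <- p].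
Proof.
move=> wf emb [p0 [v W] u1 u2]; split.
- by case: p p0 {W u1 u2}.
- by exists (f.1 v); apply: walk_map emb W.
- have [_ inj _] := emb; rewrite -map_comp /= (map_comp f.2 fst) map_inj_in_uniq //.
  move=> _ _ /mapP[d Hd ->] /mapP[d' Hd' ->]; apply: inj.
    by case: (walk_nodes wf W Hd).
  by case: (walk_nodes wf W Hd').
- have [inj _ E] := emb; rewrite -map_comp.
  rewrite (_ : map _ p = map f.1 (map (dart_start G) p)).
    rewrite map_inj_in_uniq // => _ _ /mapP[d Hd ->] /mapP[d' Hd' ->]; apply: inj.
      by case: (walk_nodes wf W Hd).
    by case: (walk_nodes wf W Hd').
  rewrite -map_comp; apply/eq_in_map => d Hd /=.
  have [He _ _] := walk_nodes wf W Hd; have [_ s t] := E _ He.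
  by rewrite /dart_start /= s t; case: (d.2).
Qed.

(** Indegrees at most 1 mean that distinct edges have distinct targets, a form that is easy to
    transport along embeddings. *)
Lemma treeP G : wf_graph G -> (tree G <->
  [/\ nodes G <> fset0, connected G, forall p, ~ cyc G p
    & {in edges G &, injective (tgt G)}]).
Proof.
move=> wf; split=> -[? ? ? I]; split=> //.
  move=> e e' He He' E; apply/eqP; apply/negPn/negP=> ne.
  have [_ t] := wf _ He; have := I _ t; apply/negP; rewrite -ltnNge.
  have <- : #|` [fset e; e']| = 2 by rewrite cardfs2 ne.
  apply: fsubset_leq_card; apply/fsubsetP=> x; rewrite !inE.
  by case/orP=> /eqP->; rewrite ?He ?He' ?E eqxx.
move=> v _; rewrite /indegree; have [->|[e]] := fset_0Vmem [fset e in edges G | tgt G e == v].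
  by rewrite cardfs0.
rewrite !inE => /andP[He /eqP Et]; rewrite -(cardfs1 e).
apply: fsubset_leq_card; apply/fsubsetP=> e'; rewrite !inE => /andP[He' /eqP Et'].
by apply/eqP; apply: I; rewrite // Et.
Qed.

(** Walks are carried from [G] to [H] by [f], which gives connectedness; cycles and edges with a
    common target are carried from [H] to [G] by [f'], where they are excluded. *)
Lemma tree_embedding G H f f' : wf_graph G -> wf_graph H ->
  embedding G H f -> embedding H G f' ->
  {in nodes G, forall v, f.1 v \in nodes H} ->
  {in nodes H, forall v, f'.1 v \in nodes G} ->
  {in nodes H, cancel f'.1 f.1} -> tree G -> tree H.
Proof.
move=> wfG wfH emb emb' fV fV' K /(treeP wfG)[n0 co ac inj]; apply/(treeP wfH); split.
- by have [//|[v Hv]] := fset_0Vmem (nodes G); move=> E; have := fV _ Hv; rewrite E.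
- move=> u v Hu Hv; have [p W] := co _ _ (fV' _ Hu) (fV' _ Hv).
  have := walk_map emb W; rewrite !K //; by eexists; eassumption.
- by move=> p /(cyc_map wfH emb'); apply: ac.
- have [_ injE E] := emb'; move=> e e' He He' Et; apply: injE => //.
  have [E1 _ t1] := E _ He; have [E2 _ t2] := E _ He'.
  by apply: inj; rewrite // t1 t2 Et.
Qed.

Lemma iso_embedding G H f f' : morphism G H f ->
  {in nodes G, cancel f.1 f'.1} -> {in edges G, cancel f.2 f'.2} -> embedding G H f.
Proof.
move=> M K1 K2; split; [exact: can_in_inj K1|exact: can_in_inj K2|].
by move=> e He; rewrite (mor_edge M He) (mor_src M He) (mor_tgt M He).
Qed.

Lemma iso_tree G H : tlrg G -> iso G H -> tree G -> tree H.
Proof.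
move=> tG GH; have [wfH _] := iso_tlrg GH tG; case: tG => wfG _.
case: GH => f [f' [M M' [K1 K2] [K1' K2']]].
apply: (tree_embedding (f := f) (f' := f')) => //; try exact: mor_node.
  exact: iso_embedding M K1 K2.
exact: iso_embedding M' K1' K2'.
Qed.

Lemma tree_moved G v w : wf_graph G -> tree (moved G v w) <-> tree G.
Proof.
by move=> wf; split; apply: (tree_embedding (f := (id, id)) (f' := (id, id))) => //; split.
Qed.

(* For a closed walk ([u = v]), the starts of the darts permute their ends. *)
Lemma walk_start_end G u p v : walk G u p v ->
  u :: [seq dart_end G d | d <- p] = rcons [seq dart_start G d | d <- p] v.
Proof. by elim: p u => [u /= ->|d p IH u [_ <- /IH /= ->]]. Qed.

(** * Pendant edges and pruning *)

Lemma uniq_map_inj (T S : eqType) (f : T -> S) s :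
  uniq (map f s) -> {in s &, injective f}.
Proof.
elim: s => //= z s IH /andP[/mapP nz /IH inj] x y.
rewrite !inE => /predU1P[->|Hx] /predU1P[->|Hy] // E; last exact: inj.
  by case: nz; exists y.
by case: nz; exists x.
Qed.

(** A cycle through [e] would both enter and leave the leaf [tgt G e]. The only dart ending there is
    [(e, true)] and the only one starting there is [(e, false)], so the cycle would use the edge [e]
    twice. *)
Lemma leaf_not_on_cyc G e p :
  src G e <> tgt G e ->
  (forall e', e' \in edges G -> e' <> e -> src G e' <> tgt G e /\ tgt G e' <> tgt G e) ->
  wf_graph G -> cyc G p -> e \notin [seq d.1 | d <- p].
Proof.
move=> ne D wf [_ [v W] uE _]; apply/negP=> /mapP[d Hd Ed].
have E := walk_start_end W.
have pE : perm_eq [seq dart_end G d | d <- p] [seq dart_start G d | d <- p].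
  by rewrite -(perm_cons v) E perm_rcons.
have inE' : (tgt G e \in [seq dart_end G d | d <- p])
            && (tgt G e \in [seq dart_start G d | d <- p]).
  rewrite -(perm_mem pE) andbb; case Eb: (d.2).
    by apply/mapP; exists d; rewrite // /dart_end Eb Ed.
  by rewrite (perm_mem pE); apply/mapP; exists d; rewrite // /dart_start Eb Ed.
case/andP: inE' => /mapP[d1 H1 E1] /mapP[d2 H2 E2].
have [He1 _ _] := walk_nodes wf W H1; have [He2 _ _] := walk_nodes wf W H2.
have Q1 : d1 = (e, true).
  have Q : d1.1 = e.
    apply/eqP/negPn/negP=> /eqP /(D _ He1)[s t].
    by move: E1; rewrite /dart_end; case: (d1.2) => /esym.
  by move: E1; rewrite /dart_end Q; move: Q; case: (d1) => x [] /= -> // /esym.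
have Q2 : d2 = (e, false).
  have Q : d2.1 = e.
    apply/eqP/negPn/negP=> /eqP /(D _ He2)[s t].
    by move: E2; rewrite /dart_start; case: (d2.2) => /esym.
  by move: E2; rewrite /dart_start Q; move: Q; case: (d2) => x [] /= -> // /esym.
by have := uniq_map_inj uE H1 H2; rewrite Q1 Q2 => /(_ erefl).
Qed.

(** From the pruned graph to [G], the leaf is joined to the rest by [e], and no cycle of [G] uses
    [e]. From [G] to the pruned graph, walks are retracted by sending the leaf to its parent. *)
Lemma tree_pruned a G e : tlrg G -> prunable a G e -> tree (pruned G e) <-> tree G.
Proof.
move=> tG pr; have [wf _] := tG; have [wf' _] := pruned_tlrg tG pr.
have [Hs Ht Hs'] := prunable_nodes tG pr; case: pr => He ne _ _ D.
have emb : embedding (pruned G e) G (id, id).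
  by split=> // e' /=; rewrite !inE => /andP[].
have eE e' : (e' \in edges (pruned G e)) = (e' != e) && (e' \in edges G).
  by rewrite !inE.
have vE v : (v \in nodes (pruned G e)) = (v != tgt G e) && (v \in nodes G).
  by rewrite !inE.
split=> [/(treeP wf')|/(treeP wf)] -[n0 co ac inj].
- apply/(treeP wf); split.
  + by move=> E; move: Hs; rewrite E.
  + have fromP u : u \in nodes G -> exists2 u', u' \in nodes (pruned G e) &
        (exists p, walk G u p u') /\ (exists p, walk G u' p u).
      move=> Hu; have [->|neq] := eqVneq u (tgt G e); last first.
        by exists u; [rewrite vE neq|split; exists [::]].
      exists (src G e) => //; split; first by exists [:: (e, false)].
      by exists [:: (e, true)].
    move=> u v /fromP[u' Hu' [[p Wp] _]] /fromP[v' Hv' [_ [q Wq]]].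
    have [r Wr] := co _ _ Hu' Hv'.
    exists (p ++ (map (fun d => (id d.1, d.2)) r ++ q)).
    by apply: walk_cat Wp _; apply: walk_cat (walk_map emb Wr) Wq.
  + move=> p C; apply: (ac p); have := leaf_not_on_cyc ne D wf C.
    case: C => p0 [v W] u1 u2 /mapP ninE; split=> //; exists v.
    (* Only the occurrences of [v] as a starting point are generalised: the induction is over walks
       from any node to the fixed end [v]. *)
    elim: p {1 3}v W ninE {p0 u1 u2} => //= d p IH u [He' ds W] ninE; split=> //.
      by rewrite eE He' andbT; apply/eqP=> E; case: ninE; exists d; rewrite ?inE ?eqxx.
    by apply: IH W _ => -[d' Hd' E]; case: ninE; exists d'; rewrite // inE Hd' orbT.
  + move=> e1 e2 H1 H2 E.
    have [E1|/eqP N1] := eqVneq e1 e; have [E2|/eqP N2] := eqVneq e2 e.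
    * by rewrite E1 E2.
    * by case: (D _ H2 N2); rewrite -E E1.
    * by case: (D _ H1 N1); rewrite E E2.
    * by apply: inj; rewrite ?eE ?H1 ?H2 ?andbT //; apply/eqP.
- apply/(treeP wf'); split.
  + by move=> E; move: Hs'; rewrite E.
  + pose rho v := if v == tgt G e then src G e else v.
    (* the leaf is retracted to its neighbour *)
    have retract u p v : walk G u p v -> exists q, walk (pruned G e) (rho u) q (rho v).
      elim: p u => [u ->|d p IH u [He' <- /IH[q W]]]; first by exists [::].
      have [E|ned] := eqVneq d.1 e.
        have rs : rho (src G e) = src G e by rewrite /rho; case: eqP.
        have rt : rho (tgt G e) = src G e by rewrite /rho eqxx.
        by exists q; move: W; rewrite /dart_start /dart_end E; case: (d.2); rewrite rs rt.
      have [/eqP/negPf s /eqP/negPf t] := D _ He' (elimN eqP ned).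
      exists (d :: q); split; first by rewrite eE ned.
        by rewrite /rho /dart_start; case: (d.2); rewrite ?s ?t.
      by move: W; rewrite /rho /dart_end; case: (d.2); rewrite ?s ?t.
    move=> u v; rewrite !vE => /andP[/negPf nu Hu] /andP[/negPf nv Hv].
    have [p /retract] := co _ _ Hu Hv; by rewrite /rho nu nv.
  + by move=> p /(cyc_map wf' emb); apply: ac.
  + by move=> e1 e2; rewrite !eE => /andP[_ H1] /andP[_ H2]; apply: inj.
Qed.

Lemma step_tree G H : step tree_rules G H -> tree H <-> tree G.
Proof.
have isoE K L : tlrg K -> iso K L -> tree L <-> tree K.
  move=> tK KL; split; last exact: iso_tree.
  by apply: iso_tree (iso_sym KL); apply: iso_tlrg KL tK.
case/step_treeP=> tG [[a [e [pr]]]|[v [w [mv]]]] /isoE->.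
- exact: tree_pruned pr.
- exact: pruned_tlrg pr.
- by apply: tree_moved; case: tG.
- exact: moved_tlrg.
Qed.

(** * Nodes labelled [Triangle] and irreducible trees *)

(* In a tree, following the edges [e] from a node labelled [Triangle] leads *)
(* to the root node.                                                        *)
Definition trail G : Prop := forall t, t \in nodes G -> nlab G t = Some Triangle ->
  exists2 e, e \in edges G & src G e = t /\
    (nlab G (tgt G e) = Some Triangle \/ rtd G (tgt G e) = Some true).

Lemma iso_trail G H : tlrg G -> iso G H -> trail G -> trail H.
Proof.
move=> [wf tot] [f [f' [M M' _ [K _]]]] T t Ht; rewrite -(K _ Ht).
have Ht' := mor_node M' Ht; move=> Tt.
have Tt' : nlab G (f'.1 t) = Some Triangle.
  by apply: (mor_nlab M') => //; rewrite -(K _ Ht).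
have [e He [se te]] := T _ Ht' Tt'; have [_ tG] := wf _ He.
exists (f.2 e); first exact: mor_edge M _ He.
rewrite (mor_src M He) (mor_tgt M He) se; split=> //.
by case: te => te; [left; apply: (mor_nlab M)|right; apply: (mor_rtd M)].
Qed.

(** An edge leaving a remaining [Triangle] node is not [e], whose source becomes [Square], and so
    survives. If it ends at [src G e], it ends at the new root; any other target keeps its label and
    rootedness. *)
Lemma trail_pruned a G e : {in edges G &, injective (tgt G)} -> prunable a G e ->
  trail G -> trail (pruned G e).
Proof.
move=> inj [He ne _ _ D] T t /=; rewrite !inE => /andP[nt Ht].
case: eqP => // nts /(T _ Ht)[e' He' [se te]].
have ne' : e' <> e by move=> E; apply: nts; rewrite -se E.
exists e'; first by rewrite !inE He' andbT; apply/eqP.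
split=> //; case: eqP; first by right.
by [].
Qed.

(** The old root becomes a [Triangle] with an edge to the new root, and edges that ended at the old
    root now end at a [Triangle]. *)
Lemma trail_moved G v w : movable G v w -> trail G -> trail (moved G v w).
Proof.
move=> [[e He [se te]] ne [l1 l2] [p1 p2]] T t Ht; rewrite /moved /=.
case: eqP => [-> _|nt /(T _ Ht)[e' He' [se' te']]].
  by exists e => //; split=> //; right; rewrite te eqxx.
exists e' => //; split=> //; case: (tgt G e' =P v) => [_|nv]; first by left.
by case: (tgt G e' =P w) => [_|_]; [right|].
Qed.

(** Pigeonhole: choosing an outgoing edge that stays in [S] gives a map whose iterates must repeat,
    and the first repetition closes a cycle of forward darts. *)
Lemma successors_cyc G (S : pred nat) x0 : S x0 ->
  (forall x, S x -> x \in nodes G /\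
     exists2 e, e \in edges G & src G e = x /\ S (tgt G e)) ->
  exists p, cyc G p.
Proof.
move=> Sx0 Sn.
pose out x := head 0 [seq e <- edges G | (src G e == x) && S (tgt G e)].
have outP x : S x -> [/\ out x \in edges G, src G (out x) = x & S (tgt G (out x))].
  move=> /Sn[_ [e He [se te]]].
  have : out x \in [seq e <- edges G | (src G e == x) && S (tgt G e)].
    have : e \in [seq e <- edges G | (src G e == x) && S (tgt G e)].
      by rewrite mem_filter se eqxx te He.
    by rewrite /out; case: filter => //= z s _; rewrite inE eqxx.
  by rewrite mem_filter => /andP[/andP[/eqP ? ?] ?].
pose f x := tgt G (out x).
have Sf i x : S x -> S (iter i f x) by elim: i => //= i IH /IH/outP[].
have tW k z : S z -> walk G z [seq (out y, true) | y <- traject f z k] (iter k f z).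
  elim: k z => //= k IH z Sz; have [He se te] := outP _ Sz.
  by split=> //; rewrite -iterS iterSr; apply: IH.
have exL : exists n, looping f x0 n.
  exists #|` nodes G|; apply: contraT; rewrite -looping_uniq => /uniq_leq_size le.
  have /le : {subset traject f x0 #|` nodes G|.+1 <= nodes G}.
    by move=> _ /trajectP[i _ ->]; case: (Sn _ (Sf i _ Sx0)).
  by rewrite size_traject ltnn.
(* By minimality the first [m.+1] iterates are distinct; the next one equals the iterate at some
   position [i], and the [k] iterates from there on form the cycle. *)
case: (ex_minnP exL) => -[//|m] Lm minm.
have uq : uniq (traject f x0 m.+1).
  by rewrite looping_uniq; apply/negP=> /minm; rewrite ltnn.
have /trajectP[i ltim Ei] := Lm.
have Sy := Sf i _ Sx0; set y := iter i f x0 in Ei Sy.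
set k := m.+1 - i; have k0 : 0 < k by rewrite subn_gt0.
have Ek : iter k f y = y by rewrite -iterD subnK // ltnW.
have uk : uniq (traject f y k).
  have := drop_uniq i uq; rewrite (_ : drop i _ = traject f y k) //.
  rewrite -(subnK (ltnW ltim)) addnC trajectD drop_size_cat // size_traject //.
have st z : z \in traject f y k -> src G (out z) = z.
  by case/trajectP=> j _ ->; case: (outP _ (Sf j _ Sy)).
exists [seq (out z, true) | z <- traject f y k]; split.
- by case: (k) k0.
- by exists y; have := tW k _ Sy; rewrite Ek.
- rewrite -map_comp map_inj_in_uniq // => a b Ha Hb /= E.
  by rewrite -(st _ Ha) -(st _ Hb) E.
- rewrite -map_comp map_inj_in_uniq // => a b Ha Hb /=.
  by rewrite /dart_start /= !st.
Qed.

Lemma irreducible_treeP G : tlrg G -> irreducible tree_rules G <->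
  (forall a e, ~ prunable a G e) /\ (forall v w, ~ movable G v w).
Proof.
move=> tG; split=> [irr|[np nm] r].
  split=> [a e /(prunable_applies tG)[_ [g [h [X [M _ _]]]]]|v w].
    apply: (irr (prune_rule a)); last by exists g.
    by case: a {M}; [constructor 1|constructor 2].
  move=> /(movable_applies tG)[_ [g [h [X [M _ _]]]]].
  by apply: (irr r2); [constructor 3|exists g].
by case=> -> [g]; [move=> /match_pruneP[/np]|move=> /match_pruneP[/np]|move=> /match_r2P[/nm]].
Qed.

Lemma rooted_unrooted G v w : tlrg G -> rooted_at G v -> w \in nodes G -> w <> v ->
  rtd G w = Some false.
Proof.
move=> [_ tot] [_ _ _ u] Hw ne; have [_] := tot _ Hw.
by case E: rtd => [[]|] // _; case: ne; apply: u.
Qed.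

(** A [Square] child of the root would enable [r2]; with a [Triangle] child, the set [S] would be
    closed under a choice of successors and produce a cycle. Without outgoing edges, a root with an
    incoming edge is prunable, since no second edge can share its target. So the root is
    isolated. *)
Lemma irreducible_tree G : well_rooted G -> tree G -> trail G ->
  irreducible tree_rules G -> single_square_root G.
Proof.
move=> [tG [v rv]] TG trG /(irreducible_treeP tG)[np nm].
have [wf tot] := tG; have [_ co ac inj] := (treeP wf).1 TG.
have [Hv lv pv u] := rv.
pose S x := (x \in nodes G) && ((nlab G x == Some Triangle) || (rtd G x == Some true)).
have noloop e : e \in edges G -> src G e <> tgt G e.
  move=> He E; apply: (ac [:: (e, true)]); split=> //; exists (src G e).
  by split=> //; rewrite E.
have noout e : e \in edges G -> src G e <> v.
  move=> He se; have [_ Ht] := wf _ He.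
  have nt : tgt G e <> v by rewrite -se => /esym/noloop; apply.
  have pt := rooted_unrooted tG rv Ht nt.
  have lt : nlab G (tgt G e) = Some Triangle.
    have [] := tot _ Ht; case lt: nlab => [[]|] // _ _.
    by case: (nm v (tgt G e)); split=> //; [exists e|move/esym].
  have [||p] := successors_cyc (G := G) (S := S) (x0 := v); last exact: ac.
    by rewrite /S Hv pv eqxx orbT.
  move=> x /andP[Hx xS]; split=> //.
  have [<-|ne] := eqVneq (src G e) x; first by exists e; rewrite // /S Ht lt eqxx.
  case/orP: xS => [/eqP/(trG _ Hx)[e' He' [se' te']]|/eqP/(u _ Hx) E].
    exists e' => //; split=> //; have [_ Ht'] := wf _ He'.
    by rewrite /S Ht'; case: te' => ->; rewrite eqxx ?orbT.
  by rewrite E se eqxx in ne.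
have noin e : e \in edges G -> tgt G e <> v.
  move=> He te; have [Hs Ht] := wf _ He; have ne := noloop _ He.
  have [] := tot _ Hs; case ls: nlab => [a|] // _ _.
  apply: (np a e); split=> //; rewrite ?te //.
  - by split=> //; apply: rooted_unrooted rv Hs _; rewrite // -te.
  - by move=> e' He' ne'; split=> [/(noout _ He')//|E]; apply: ne'; apply: inj; rewrite // te.
have all_v x : x \in nodes G -> x = v.
  move=> Hx; have [[//|d p]] := co _ _ Hv Hx.
  by case=> He; rewrite /dart_start; case: (d.2) => E; [case: (noout _ He)|case: (noin _ He)].
split.
  by have [//|[e He]] := fset_0Vmem (edges G); case: (wf _ He) => /all_v/(noout _ He).
exists v; split=> //; apply/fsetP=> x; rewrite inE.
by apply/idP/eqP=> [/all_v|->].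
Qed.

Lemma single_square_root_tree H : single_square_root H -> tree H.
Proof.
case=> E [v [V _ _]]; have wf : wf_graph H by move=> e; rewrite E.
apply/(treeP wf); split.
- by rewrite V => /fsetP/(_ v); rewrite !inE eqxx.
- by move=> x y; rewrite V !inE => /eqP-> /eqP->; exists [::].
- by case=> [|d p] [p0 [x W] _ _]; [case: p0|case: W; rewrite E].
- by move=> e; rewrite E.
Qed.

Lemma derives_tree G H : well_rooted G -> derives tree_rules G H -> tree H <-> tree G.
Proof.
move=> pG D; elim: D pG => [K L KL [tK _]|K X L st _ IH pK].
  split; last exact: iso_tree.
  by apply: iso_tree (iso_sym KL); apply: iso_tlrg KL tK.
by rewrite (IH (step_well_rooted pK st)) (step_tree st).
Qed.

Lemma step_trail G H : tree G -> step tree_rules G H -> trail G -> trail H.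
Proof.
move=> TG /step_treeP[tG [[a [e [pr]]]|[v [w [mv]]]]] XH trG.
  have [wf _] := tG; have [_ _ _ inj] := (treeP wf).1 TG.
  by apply: iso_trail XH _; [exact: pruned_tlrg pr|exact: trail_pruned pr trG].
by apply: iso_trail XH _; [exact: moved_tlrg|exact: trail_moved].
Qed.

Lemma derives_trail G H : well_rooted G -> tree G -> derives tree_rules G H ->
  trail G -> trail H.
Proof.
move=> pG TG D; elim: D pG TG => [K L KL [tK _] _|K X L st _ IH pK TK trK].
  exact: iso_trail KL.
apply: IH; first exact: step_well_rooted st.
  by apply/(step_tree st).
exact: step_trail st trK.
Qed.

Lemma normal_form_tree G H : input_graph G -> normal_form tree_rules G H ->
  single_square_root H <-> tree G.
Proof.
move=> iG [D irr]; have pG := input_well_rooted iG; split.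
  by move/single_square_root_tree/(derives_tree pG D).
move=> TG; apply: irreducible_tree irr.
- exact: derives_well_rooted D.
- exact/(derives_tree pG D).
(* Input graphs have no [Triangle] node, so [trail] holds vacuously at the start. *)
- apply: derives_trail D _ => // t Ht lt; case: iG => _ _ /(_ _ Ht); by rewrite lt.
Qed.

(** * The program *)

(** [halts_within] for an arbitrary stack of commands. The rules below act as weakest preconditions
    in which [N] is the remaining budget. *)
Definition safe (c : config) (N : nat) (Q : state -> Prop) : Prop :=
  forall n k s', runs c n (k, s') ->
    n <= N /\ (if k is [::] then Q s' else exists m c', exec (k, s') m c').

Lemma safe_weaken c M N Q : safe c M Q -> M <= N -> safe c N Q.
Proof. by move=> S le n k s' /S[le' ?]; split=> //; apply: leq_trans le' le. Qed.

Lemma safe_halt s N (Q : state -> Prop) : Q s -> safe ([::], s) N Q.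
Proof.
move=> Qs n k s' R; inversion R as [|c1 n1 c2 m c3 X]; first by subst.
by inversion X.
Qed.

Lemma safe_step c k s N Q : (exists m c', exec (c :: k, s) m c') ->
  (forall m c', exec (c :: k, s) m c' -> m <= N /\ safe c' (N - m) Q) ->
  safe (c :: k, s) N Q.
Proof.
move=> ex S n k' s' R; inversion R as [|c1 n1 c2 m c3 X Y]; first by subst.
subst; have [le /(_ _ _ _ Y)[le' ?]] := S _ _ X; split=> //.
by rewrite -(subnKC le) leq_add2l.
Qed.

Lemma safe_det c k s c1 N Q : exec (c :: k, s) 1 c1 ->
  (forall m c', exec (c :: k, s) m c' -> m = 1 /\ c' = c1) ->
  safe c1 N Q -> safe (c :: k, s) N.+1 Q.
Proof.
move=> X det S; apply: safe_step; first by exists 1, c1.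
by move=> m c' /det[-> ->]; rewrite subn1.
Qed.

Ltac exec_inv :=
  move=> ? ? X; inversion X; subst;
  repeat match goal with
  | H1 : ?a = Some _, H2 : ?a = Some _ |- _ => rewrite H1 in H2; case: H2 => ?; subst
  | H1 : ?a = _ :: _, H2 : ?a = _ :: _ |- _ => rewrite H1 in H2; case: H2 => ? ?; subst
  end.

Section Instructions.
Variables (k : seq cmd) (s : state) (N : nat) (Q : state -> Prop).

Lemma safe_Seq c1 c2 : safe ([:: c1, c2 & k], s) N Q ->
  safe (Seq c1 c2 :: k, s) N.+1 Q.
Proof.
apply: safe_det; first exact: exec_Seq.
by exec_inv.
Qed.

Lemma safe_If t c1 c2 b : eval s t = Some b ->
  safe ((if b then c1 else c2) :: k, s) N Q -> safe (If t c1 c2 :: k, s) N.+1 Q.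
Proof.
move=> E; apply: safe_det; first exact: exec_If.
by exec_inv.
Qed.

Lemma safe_While t c b : eval s t = Some b ->
  safe (if b then [:: c, While t c & k] else k, s) N Q ->
  safe (While t c :: k, s) N.+1 Q.
Proof.
move=> E; apply: safe_det; first exact: exec_While.
by exec_inv.
Qed.

Lemma safe_Push l x v : reg s x = Some v ->
  safe (k, set_lst l (v :: lst s l) s) N Q -> safe (Push l x :: k, s) N.+1 Q.
Proof.
move=> E; apply: safe_det; first exact: exec_Push.
by exec_inv.
Qed.

Lemma safe_Pop l x v vs : lst s l = v :: vs ->
  safe (k, set_reg x v (set_lst l vs s)) N Q -> safe (Pop l x :: k, s) N.+1 Q.
Proof.
move=> E; apply: safe_det; first exact: exec_Pop.
by exec_inv.
Qed.

Lemma safe_Source x y e : edge_at s y = Some e ->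
  safe (k, set_reg x (src (store s) e) s) N Q -> safe (Source x y :: k, s) N.+1 Q.
Proof.
move=> E; apply: safe_det; first exact: exec_Source.
by exec_inv.
Qed.

(** The order of the answer is arbitrary, so the continuation has to be safe for every enumeration
    of [A]. *)
Lemma safe_Fetch l q (A : {fset nat}) M : answer s q = Some A -> #|` A| <= M ->
  (forall vs, uniq vs -> vs =i A -> safe (k, set_lst l vs s) N Q) ->
  safe (Fetch l q :: k, s) (N + M.+1) Q.
Proof.
move=> E le S; apply: safe_step.
  by exists (size A).+1, (k, set_lst l A s); apply: exec_Fetch E _ _.
exec_inv.
match goal with U : is_true (uniq ?vs), I : ?vs =i _ |- _ =>
  have sz := perm_size (uniq_perm U (fset_uniq _) I); have {}S := S _ U I
end.
rewrite sz; split; first by rewrite (leq_trans _ (leq_addl _ _)) // ltnS.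
by apply: safe_weaken S _; rewrite -addnBA ?leq_addr // ltnS.
Qed.

Lemma safe_DelNode x v : node_at s x = Some v -> degree (store s) v = 0 ->
  safe (k, set_store (del_node (store s) v) s) N Q -> safe (DelNode x :: k, s) N.+1 Q.
Proof.
move=> E D; apply: safe_det; first exact: exec_DelNode.
by exec_inv.
Qed.

Lemma safe_DelEdge x e : edge_at s x = Some e ->
  safe (k, set_store (del_edge (store s) e) s) N Q -> safe (DelEdge x :: k, s) N.+1 Q.
Proof.
move=> E; apply: safe_det; first exact: exec_DelEdge.
by exec_inv.
Qed.

Lemma safe_SetLabel x a v : node_at s x = Some v ->
  safe (k, set_store (set_label (store s) v a) s) N Q ->
  safe (SetLabel x a :: k, s) N.+1 Q.
Proof.
move=> E; apply: safe_det; first exact: exec_SetLabel.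
by exec_inv.
Qed.

Lemma safe_SetRoot x b v : node_at s x = Some v ->
  safe (k, set_store (set_root (store s) v b) s) N Q ->
  safe (SetRoot x b :: k, s) N.+1 Q.
Proof.
move=> E; apply: safe_det; first exact: exec_SetRoot.
by exec_inv.
Qed.

End Instructions.

(** * The program for one derivation *)

Definition prune_cmd : cmd :=
  Seq (Fetch 1 (InEdges 0 ESquare)) (Seq (Pop 1 1) (Seq (Source 2 1)
  (Seq (DelEdge 1) (Seq (DelNode 0) (Seq (SetLabel 2 Square) (SetRoot 2 true)))))).

(* Labelling the root node [Triangle] before the query removes it from its *)
(* own list of neighbours, in case it has a loop.                          *)
Definition move_cmd : cmd :=
  Seq (SetLabel 0 Triangle) (Seq (Fetch 1 (OutNeighbours 0 Square))
  (If (IsEmpty 1) (Seq (SetLabel 0 Square) (Push 0 0))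
     (Seq (Pop 1 1) (Seq (SetRoot 0 false) (SetRoot 1 true))))).

(** Register 0 holds the root. With positive indegree and degree at most 1 it is a leaf below a
    parent and can be pruned, whatever the label of the parent, as [r0] and [r1] cover both cases.
    Otherwise only [r2] can apply; a root with a loop has degree at least 2 and falls in this
    case. *)
Definition rewrite_cmd : cmd :=
  Seq (Fetch 1 RootNodes) (Seq (Pop 1 0)
  (If (CountLeq (InDegree 0) 0) move_cmd
     (If (CountLeq (Degree 0) 1) prune_cmd move_cmd))).

Lemma in_edges_prunable a G e : prunable a G e ->
  [fset e' in edges G | tgt G e' == tgt G e] = [fset e].
Proof.
move=> [He _ _ _ D]; apply/fsetP=> e'; rewrite !inE.
apply/andP/eqP=> [[He' /eqP E]|->]; last by rewrite He eqxx.
by apply/eqP/negPn/negP=> /eqP /(D _ He')[].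
Qed.

Lemma out_edges_prunable a G e : prunable a G e ->
  [fset e' in edges G | src G e' == tgt G e] = fset0.
Proof.
move=> [He ne _ _ D]; apply/fsetP=> e'; rewrite !inE.
apply/andP=> -[He' /eqP E]; have [E'|/eqP ne'] := eqVneq e' e.
  by rewrite E' in E.
by case: (D _ He' ne').
Qed.

Lemma degree_prunable a G e : prunable a G e ->
  indegree G (tgt G e) = 1 /\ degree G (tgt G e) = 1.
Proof.
move=> pr; rewrite /degree /indegree /outdegree.
by rewrite (in_edges_prunable pr) (out_edges_prunable pr) cardfs1 cardfs0.
Qed.

Lemma degree_prunableP G v : tlrg G -> rooted_at G v ->
  0 < indegree G v -> degree G v <= 1 ->
  exists a e, prunable a G e /\ tgt G e = v.
Proof.
move=> tG rv i0 d1; have [wf tot] := tG; have [Hv lv pv _] := rv.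
have [i1 o0] : indegree G v = 1 /\ outdegree G v = 0.
  by move: i0 d1; rewrite /degree; lia.
move/eqP/cardfs1P: i1 => [e /fsetP eE]; move/cardfs0_eq/fsetP: o0 => oE.
have := eE e; rewrite !inE eqxx => /andP[He /eqP te].
have no e' : e' \in edges G -> src G e' <> v.
  by move=> He' se; have := oE e'; rewrite !inE He' se eqxx.
have [Hs _] := wf _ He; have [] := tot _ Hs.
case ls: nlab => [a|] // _ _; exists a, e; split=> //; split; rewrite ?te //.
- exact: no.
- by split=> //; apply: rooted_unrooted rv Hs (no _ He).
- move=> e' He' ne; split; first exact: no.
  by move=> te'; have := eE e'; rewrite !inE He' te' eqxx => /esym/eqP.
Qed.

Definition move_targets G v : {fset nat} :=
  [fset w in [fset tgt G e | e in edges G & src G e == v]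
     | nlab (set_label G v Triangle) w == Some Square].

Lemma move_targetsP G v w : tlrg G -> rooted_at G v ->
  reflect (movable G v w) (w \in move_targets G v).
Proof.
move=> tG rv; have [wf _] := tG; have [_ lv pv _] := rv.
rewrite !inE /=; apply: (iffP andP) => [[/imfsetP[e /=]]|].
  rewrite inE => /andP[He /eqP se] ->; case: (tgt G e =P v) => // ne /eqP lt.
  have [_ Ht] := wf _ He; split=> //; [by exists e|by move/esym|].
  by split=> //; apply: rooted_unrooted rv Ht ne.
move=> [[e He [se te]] ne [_ lw] _]; split.
  by apply/imfsetP; exists e; rewrite //= inE He se eqxx.
by case: (w =P v) => [E|_]; [case: ne|rewrite lw].
Qed.

Lemma card_move_targets G v : #|` move_targets G v| <= degree G v.
Proof.
rewrite /degree (leq_trans _ (leq_addl _ _)) //.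
pose A := [fset e in edges G | src G e == v].
apply: (@leq_trans #|` [fset tgt G e | e in A]|); last exact: leq_imfset_card.
apply: fsubset_leq_card; apply/fsubsetP=> w; rewrite inE => /andP[/imfsetP[e He ->] _].
by apply/imfsetP; exists e; rewrite //= !inE.
Qed.

(** Equality in place of isomorphism: the program produces exactly these stores. *)
Definition rewritten G G' : Prop :=
  (exists a e, prunable a G e /\ G' = pruned G e) \/
  (exists v w, movable G v w /\ G' = moved G v w).

Lemma rewritten_step G G' : tlrg G -> rewritten G G' -> step tree_rules G G'.
Proof.
move=> tG R; apply/step_treeP; split=> //.
case: R => [[a [e [? ->]]]|[v [w [? ->]]]]; [left; exists a, e|right; exists v, w];
  by split=> //; apply: iso_refl.
Qed.

(** Used when [move_cmd] fails: restoring the label of the root gives back the same store. *)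
Lemma set_labelK G v a b : nlab G v = Some b -> set_label (set_label G v a) v b = G.
Proof.
move=> E; case: G E => V W s t l m p /= E; rewrite /set_label /=; congr Graph.
by apply: functional_extensionality => x /=; case: eqP => // ->.
Qed.

Lemma uniq_mem1 (T : eqType) (vs : seq T) x (A : pred T) : uniq vs -> vs =i A ->
  A =i pred1 x -> vs = [:: x].
Proof.
move=> U I E; apply: perm_small_eq => //; apply: uniq_perm => // y.
by rewrite I E inE.
Qed.

Lemma root_nodes G v : rooted_at G v ->
  [fset w in nodes G | rtd G w == Some true] = [fset v].
Proof.
move=> [Hv _ pv u]; apply/fsetP=> w; rewrite !inE.
by apply/andP/eqP=> [[Hw /eqP/(u _ Hw)]|->] //; rewrite Hv pv.
Qed.

Lemma in_edges_query G v : [fset e in edges G | (tgt G e == v) && (elab G e == ESquare)]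
  = [fset e in edges G | tgt G e == v].
Proof.
by apply/fsetP=> e; rewrite !inE; case: (elab G e); rewrite eqxx andbT.
Qed.

Lemma move_cmd_safe d k s v N Q :
  tlrg (store s) -> rooted_at (store s) v -> reg s 0 = Some v ->
  degree (store s) v <= d -> lst s 0 = [::] ->
  (forall a e, ~ prunable a (store s) e) ->
  (forall s', rewritten (store s) (store s') -> lst s' 0 = [::] -> safe (k, s') N Q) ->
  (forall s', store s' = store s -> irreducible tree_rules (store s) ->
     lst s' 0 <> [::] -> safe (k, s') N Q) ->
  safe (move_cmd :: k, s) (N + d + 10) Q.
Proof.
move=> tG rv Rv dv l0 np ok fail; have [Hv lv pv _] := rv.
apply: safe_weaken.
  apply: safe_Seq; apply: safe_SetLabel; first by rewrite /node_at Rv Hv.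
  apply: safe_Seq; apply: (@safe_Fetch _ _ _ _ _ _ (move_targets (store s) v) d).
  - by rewrite /= /node_at /= Rv Hv.
  - exact: leq_trans (card_move_targets _ _) dv.
  (* The budget is still open at this point; [N + 6] pays for the longer of the two branches. *)
  move=> vs _ vsE; apply: (@safe_weaken _ (N + 6)); last exact: leqnn.
  case: vs vsE => [|w vs] vsE.
    apply: safe_weaken.
      apply: safe_If => //=; apply: safe_Seq.
      apply: safe_SetLabel; first by rewrite /node_at /= Rv Hv.
      apply: safe_Push; first by rewrite /= Rv.
      apply: fail => //=; first exact: set_labelK.
      apply/(irreducible_treeP tG); split=> // v' w mv.
      have E : v' = v.
        have [Hv' _] := movable_nodes tG mv; case: rv => _ _ _ u.
        by case: mv => _ _ _ [? _]; apply: u.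
      by rewrite E in mv; have := introT (move_targetsP w tG rv) mv; rewrite -vsE.
    lia.
  have mv : movable (store s) v w by apply/(move_targetsP w tG rv); rewrite -vsE mem_head.
  have [_ Hw] := movable_nodes tG mv.
  apply: safe_weaken.
    apply: safe_If => //=; apply: safe_Seq; apply: safe_Pop => //.
    apply: safe_Seq; apply: safe_SetRoot; first by rewrite /node_at /= Rv Hv.
    apply: safe_SetRoot; first by rewrite /node_at /= Hw.
    by apply: ok => //=; right; exists v, w.
  lia.
lia.
Qed.

Lemma degree_del_edge a G e : prunable a G e -> degree (del_edge G e) (tgt G e) = 0.
Proof.
move=> pr; rewrite /degree /indegree /outdegree /=.
have -> : [fset e' in edges G `\ e | tgt G e' == tgt G e] = fset0.
  apply/fsetP=> x; rewrite !inE; have /fsetP/(_ x) := in_edges_prunable pr.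
  by rewrite !inE; case: (x == e) => //= ->.
have -> : [fset e' in edges G `\ e | src G e' == tgt G e] = fset0.
  apply/fsetP=> x; rewrite !inE; have /fsetP/(_ x) := out_edges_prunable pr.
  by rewrite !inE; case: (x == e).
by rewrite cardfs0.
Qed.

Lemma prune_cmd_safe a e k s N Q :
  tlrg (store s) -> prunable a (store s) e -> reg s 0 = Some (tgt (store s) e) ->
  (forall s', store s' = pruned (store s) e -> lst s' 0 = lst s 0 -> safe (k, s') N Q) ->
  safe (prune_cmd :: k, s) (N + 14) Q.
Proof.
move=> tG pr Rv ok; have [Hs Hv Hs'] := prunable_nodes tG pr.
have [He _ _ _ _] := pr; have wE := in_edges_prunable pr.
apply: safe_weaken.
  apply: safe_Seq; apply: (@safe_Fetch _ _ _ _ _ _ [fset e] 1).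
  - by rewrite /= /node_at /= Rv Hv /= in_edges_query wE.
  - by rewrite cardfs1.
  move=> vs U vsE; have {vsE} -> : vs = [:: e].
    by apply: uniq_mem1 U vsE _ => x; rewrite !inE.
  apply: safe_Seq; apply: safe_Pop => //.
  apply: safe_Seq; apply: safe_Source; first by rewrite /edge_at /= He.
  apply: safe_Seq; apply: safe_DelEdge; first by rewrite /edge_at /= He.
  apply: safe_Seq; apply: safe_DelNode; first by rewrite /node_at /= Rv Hv.
    exact: degree_del_edge pr.
  apply: safe_Seq; apply: safe_SetLabel; first by rewrite /node_at /= Hs'.
  apply: safe_SetRoot; first by rewrite /node_at /= Hs'.
  exact: ok.
lia.
Qed.

(** Finding the root and testing its degrees costs at most 7, moving at most [d + 10] and pruning
    14, so [d + 25] is enough. *)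
Lemma rewrite_cmd_safe d k s N Q :
  well_rooted (store s) -> degree_bounded d (store s) -> lst s 0 = [::] ->
  (forall s', rewritten (store s) (store s') -> lst s' 0 = [::] -> safe (k, s') N Q) ->
  (forall s', store s' = store s -> irreducible tree_rules (store s) ->
     lst s' 0 <> [::] -> safe (k, s') N Q) ->
  safe (rewrite_cmd :: k, s) (N + d + 25) Q.
Proof.
move=> [tG [v rv]] dG l0 ok fail; have [Hv lv pv u] := rv.
have np a e : ~ (0 < indegree (store s) v /\ degree (store s) v <= 1) ->
    ~ prunable a (store s) e.
  move=> no pr; apply: no; have [_ Hv' _] := prunable_nodes tG pr.
  have <- : tgt (store s) e = v by apply: u => //; case: pr => _ _ _ [].
  by have [-> ->] := degree_prunable pr.
apply: safe_weaken.
  apply: safe_Seq; apply: (@safe_Fetch _ _ _ _ _ _ [fset v] 1).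
  - by rewrite /= (root_nodes rv).
  - by rewrite cardfs1.
  move=> vs U vsE; have {vsE} -> : vs = [:: v].
    by apply: uniq_mem1 U vsE _ => x; rewrite !inE.
  apply: safe_Seq; apply: safe_Pop => //.
  apply: (@safe_weaken _ (N + d + 10 + 8)); last exact: leqnn.
  apply: safe_weaken.
    apply: safe_If; first by rewrite /= /node_at /= Hv.
    apply: (@safe_weaken _ (N + d + 10 + 6)); last exact: leqnn.
    case: leqP => [i0|i0].
      apply: safe_weaken.
        apply: (@move_cmd_safe d _ _ v N) => //=; first exact: dG.
        by move=> a e; apply: np => -[]; rewrite ltnNge i0.
      lia.
    apply: safe_weaken.
      apply: safe_If; first by rewrite /= /node_at /= Hv.
      apply: (@safe_weaken _ (N + d + 10 + 4)); last exact: leqnn.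
      case: leqP => [d1|d1].
        have [a [e [pr te]]] := degree_prunableP tG rv i0 d1.
        apply: safe_weaken.
          apply: (@prune_cmd_safe a e _ _ N) => //=; first by rewrite te.
          move=> s' E l; apply: ok; last by rewrite l.
          by left; exists a, e.
        lia.
      apply: safe_weaken.
        apply: (@move_cmd_safe d _ _ v N) => //=; first exact: dG.
        by move=> a e; apply: np => -[_]; rewrite leqNgt d1.
      lia.
    lia.
  lia.
lia.
Qed.

(** * Runs realising a given derivation *)

Definition reaches (c c' : config) : Prop := exists n, runs c n c'.

Lemma reaches_step c n c' c'' : exec c n c' -> reaches c' c'' -> reaches c c''.
Proof. by move=> X [m Y]; eexists; apply: runs_step X Y. Qed.

Lemma reaches_refl c : reaches c c.
Proof. by exists 0; apply: runs_refl. Qed.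

Lemma exec_If_true t c1 c2 k s : eval s t = Some true ->
  exec (If t c1 c2 :: k, s) 1 (c1 :: k, s).
Proof. exact: exec_If. Qed.

Lemma exec_If_false t c1 c2 k s : eval s t = Some false ->
  exec (If t c1 c2 :: k, s) 1 (c2 :: k, s).
Proof. exact: exec_If. Qed.

Ltac run tac := eapply reaches_step; [tac|].

Definition at_root s v := set_reg 0 v (set_lst 1 [::] (set_lst 1 [:: v] s)).

Lemma rewrite_cmd_root s v c : rooted_at (store s) v ->
  reaches ([:: If (CountLeq (InDegree 0) 0) move_cmd
             (If (CountLeq (Degree 0) 1) prune_cmd move_cmd)], at_root s v) c ->
  reaches ([:: rewrite_cmd], s) c.
Proof.
move=> rv K.
run ltac:(exact: exec_Seq).
run ltac:(apply: (@exec_Fetch _ _ _ _ [fset v] [:: v])).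
- by rewrite /= (root_nodes rv).
- by [].
- by move=> x; rewrite !inE.
run ltac:(exact: exec_Seq).
by run ltac:(by apply: exec_Pop).
Qed.

Lemma prune_reachable a e s : tlrg (store s) -> rooted_at (store s) (tgt (store s) e) ->
  prunable a (store s) e ->
  exists s', [/\ returns rewrite_cmd s s', lst s' 0 = lst s 0
               & store s' = pruned (store s) e].
Proof.
move=> tG rv pr; have [Hs Hv Hs'] := prunable_nodes tG pr.
have [He _ _ _ _] := pr; have wE := in_edges_prunable pr.
have [i1 d1] := degree_prunable pr.
eexists; split; first apply: (rewrite_cmd_root rv).
  run ltac:(apply: exec_If_false; by rewrite /= /node_at /= Hv /= i1).
  run ltac:(apply: exec_If_true; by rewrite /= /node_at /= Hv /= d1).
  run ltac:(exact: exec_Seq).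
  run ltac:(apply: (@exec_Fetch _ _ _ _ [fset e] [:: e])).
  - by rewrite /= /node_at /= Hv /= in_edges_query wE.
  - by [].
  - by move=> x; rewrite !inE.
  run ltac:(exact: exec_Seq).
  run ltac:(by apply: exec_Pop).
  run ltac:(exact: exec_Seq).
  run ltac:(apply: exec_Source; by rewrite /edge_at /= He).
  run ltac:(exact: exec_Seq).
  run ltac:(apply: exec_DelEdge; by rewrite /edge_at /= He).
  run ltac:(exact: exec_Seq).
  run ltac:(apply: exec_DelNode; [by rewrite /node_at /= Hv|exact: degree_del_edge pr]).
  run ltac:(exact: exec_Seq).
  run ltac:(apply: exec_SetLabel; by rewrite /node_at /= Hs').
  run ltac:(apply: exec_SetRoot; by rewrite /node_at /= Hs').
  exact: reaches_refl.
by [].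
by [].
Qed.

Lemma move_reachable v w s : tlrg (store s) -> rooted_at (store s) v ->
  movable (store s) v w ->
  exists s', [/\ returns rewrite_cmd s s', lst s' 0 = lst s 0
               & store s' = moved (store s) v w].
Proof.
move=> tG rv mv; have [Hv Hw] := movable_nodes tG mv.
have Tw := introT (move_targetsP w tG rv) mv.
(* A movable root has an outgoing edge and so is no leaf: the tests lead to [move_cmd]. *)
have notprune : ~ (0 < indegree (store s) v /\ degree (store s) v <= 1).
  have [[e He [se te]] ne _ _] := mv.
  case=> i0 d1; have [a [e' [pr te']]] := degree_prunableP tG rv i0 d1.
  by have /fsetP/(_ e) := out_edges_prunable pr; rewrite !inE He se te' eqxx.
have reachmove : forall c, reaches ([:: move_cmd], at_root s v) c ->
    reaches ([:: rewrite_cmd], s) c.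
  move=> c K; apply: (rewrite_cmd_root rv).
  have [i0|i0] := leqP (indegree (store s) v) 0.
    run ltac:(apply: exec_If_true; by rewrite /= /node_at /= Hv /= i0).
    exact: K.
  run ltac:(apply: exec_If_false; by rewrite /= /node_at /= Hv /= leqNgt i0).
  run ltac:(apply: exec_If_false; rewrite /= /node_at /= Hv /=; congr Some;
    by apply/negbTE/negP=> d1; apply: notprune).
  exact: K.
eexists; split; first apply: reachmove.
  run ltac:(exact: exec_Seq).
  run ltac:(apply: exec_SetLabel; by rewrite /node_at /= Hv).
  run ltac:(exact: exec_Seq).
  (* The answer is enumerated with [w] first, so that [Pop] selects the desired target. *)
  run ltac:(apply: (@exec_Fetch _ _ _ _ (move_targets (store s) v)
    (w :: (move_targets (store s) v `\ w)))).
  - by rewrite /= /node_at /= Hv.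
  - by rewrite /= fset_uniq andbT !inE eqxx.
  - by move=> x; rewrite in_cons in_fsetD1; case: eqP => // ->.
  run ltac:(by apply: exec_If_false).
  run ltac:(exact: exec_Seq).
  run ltac:(by apply: exec_Pop).
  run ltac:(exact: exec_Seq).
  run ltac:(apply: exec_SetRoot; by rewrite /node_at /= Hv).
  run ltac:(apply: exec_SetRoot; by rewrite /node_at /= Hw).
  exact: reaches_refl.
by [].
by [].
Qed.

Lemma rewrite_cmd_implements : implements_step tree_rules rewrite_cmd.
Proof.
move=> G s /input_well_rooted pG D nf; have pS := derives_well_rooted pG D.
have l0 : lst s 0 = [::].
  by move: nf; rewrite /failed; case: (lst s 0) => // x l []. 
have [tG [v rv]] := pS; have [Hv lv pv u] := rv; split=> [s' [n R]|X].
  (* Only the outcome matters here, so any degree bound will do; the maximum degree provides one. *)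
  pose d := \max_(x <- nodes (store s)) degree (store s) x.
  have dG : degree_bounded d (store s) by move=> x Hx; apply: leq_bigmax_seq.
  pose Q s' := (~ failed s' /\ step tree_rules (store s) (store s')) \/
     [/\ failed s', irreducible tree_rules (store s) & iso (store s) (store s')].
  have : safe ([:: rewrite_cmd], s) (0 + d + 25) Q.
    apply: rewrite_cmd_safe => // s1.
      move=> R1 l1; apply: safe_halt; left; split; first by rewrite /failed l1.
      exact: rewritten_step.
    by move=> E irr l1; apply: safe_halt; right; split=> //; rewrite E; apply: iso_refl.
  by move=> /(_ _ _ _ R)[].
case/step_treeP=> _ [[a [e [pr XH]]]|[v' [w [mv XH]]]].
  have te : tgt (store s) e = v.
    by apply: u; [case: (prunable_nodes tG pr)|case: pr => _ _ _ []].
  have [|s' [R l E]] := prune_reachable tG _ pr; first by rewrite te.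
  by exists s'; rewrite /failed l E.
have E' : v' = v.
  by apply: u; [case: (movable_nodes tG mv)|case: mv => _ _ _ []].
rewrite E' in mv XH; have [s' [R l E]] := move_reachable tG rv mv.
by exists s'; rewrite /failed l E.
Qed.

(** * The potential and the linear bound *)

Definition potential G : nat :=
  addn #|` nodes G| #|` [fset v in nodes G | nlab G v == Some Square]|.

Lemma potential_le G : potential G <= (#|` nodes G|).*2.
Proof.
rewrite -addnn leq_add2l; apply: fsubset_leq_card.
by apply/fsubsetP=> x; rewrite !inE => /andP[].
Qed.

(** Pruning removes a [Square] node, which lowers both summands by one, and relabelling its parent
    gives back at most one. Moving turns one [Square] into a [Triangle]. *)
Lemma rewritten_potential G G' : tlrg G -> rewritten G G' -> potential G' < potential G.
Proof.
move=> tG [[a [e [pr ->]]]|[v [w [mv ->]]]]; rewrite /potential.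
  have [Hs Ht Hs'] := prunable_nodes tG pr; have [_ ne [ls lt] _ _] := pr.
  set S := [fset v in nodes G | nlab G v == Some Square].
  have tS : tgt G e \in S by rewrite !inE Ht lt eqxx.
  rewrite (cardfsD1 (tgt G e) (nodes G)) Ht (cardfsD1 (tgt G e) S) tS /=.
  rewrite add1n addSn ltnS leq_add2l -add1n.
  apply: (@leq_trans #|` src G e |` (S `\ tgt G e)|).
    apply: fsubset_leq_card; apply/fsubsetP=> x; rewrite !inE /=.
    by case: (x =P src G e) => //= _; case: (x != tgt G e).
  by rewrite cardfsU1 leq_add2r; case: (_ \notin _).
have [Hv Hw] := movable_nodes tG mv; have [_ ne [lv lw] _] := mv.
rewrite ltn_add2l; set S := [fset x in nodes G | _].
rewrite (cardfsD1 v S) !inE Hv lv eqxx ltnS; apply: fsubset_leq_card.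
by apply/fsubsetP=> x; rewrite !inE /moved /=; case: (x =P v) => //= _; rewrite andbF.
Qed.

Lemma rewritten_degree d G G' : rewritten G G' -> degree_bounded d G ->
  degree_bounded d G'.
Proof.
move=> [[a [e [pr ->]]]|[v [w [mv ->]]]] dG x //; last exact: dG.
rewrite !inE => /andP[_ Hx]; apply: leq_trans (dG _ Hx); apply: leq_add;
  by apply: fsubset_leq_card; apply/fsubsetP=> y; rewrite !inE -andbA => /andP[].
Qed.

Lemma loop_safe d s : well_rooted (store s) -> degree_bounded d (store s) ->
  lst s 0 = [::] ->
  safe ([:: as_long_as_possible rewrite_cmd], s) ((potential (store s)).+1 * (d + 30))
    (fun s' => normal_form tree_rules (store s) (store s')).
Proof.
move En: (potential (store s)) => n; elim/ltn_ind: n s En => n IH s En pG dG l0.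
have [tG _] := pG.
(* One unit pays for the loop test and [d + 25] for the body. What remains covers either the rest of
   the loop, whose potential is below [n], or the final test after a failure. *)
apply: (@safe_weaken _ (n * (d + 30) + 2 + d + 25).+1); last by rewrite mulSn; lia.
apply: safe_While; first by rewrite /= l0.
apply: rewrite_cmd_safe => // s1.
  move=> R l1; have ltn := rewritten_potential tG R; rewrite En in ltn.
  have st := rewritten_step tG R.
  apply: (@safe_weaken _ ((potential (store s1)).+1 * (d + 30))).
    have S := IH _ ltn s1 erefl (step_well_rooted pG st) (rewritten_degree R dG) l1.
    move=> m k s' /S[le H]; split=> //; case: k H => // -[D irr].
    by split=> //; apply: derives_step st D.
  by rewrite (leq_trans _ (leq_addr _ _)) // leq_mul2r ltn orbT.
move=> E irr l1; rewrite addn2; apply: (@safe_While _ _ _ _ _ _ false).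
  by rewrite /=; congr Some; apply/negbTE/nilP.
by apply: safe_halt; rewrite E; split=> //; apply/derives_iso/iso_refl.
Qed.

Theorem mainTheorem7 :
  (forall G H : graph,
     input_graph G -> normal_form tree_rules G H ->
     (single_square_root H <-> tree G)) /\
  (exists P : cmd,
     implements_step tree_rules P /\
     forall d : nat, exists c : nat, forall G : graph,
       input_graph G -> degree_bounded d G ->
       halts_within (as_long_as_possible P) (init_state G)
         (c * #|` nodes G|)
         (fun s => normal_form tree_rules G (store s))).
Proof.
split; first exact: normal_form_tree.
exists rewrite_cmd; split; first exact: rewrite_cmd_implements.
(* As [potential G] is at most twice the number of nodes and there is at least one node,
   [(potential G).+1] is at most three times that number. *)
move=> d; exists (3 * (d + 30)) => G iG dG; have pG := input_well_rooted iG.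
have n0 : 0 < #|` nodes G|.
  case: pG => _ [v [Hv _ _ _]]; rewrite cardfs_gt0; apply/eqP=> E.
  by rewrite E in Hv.
apply: (safe_weaken (loop_safe (s := init_state G) pG dG erefl)).
rewrite mulnAC leq_mul2r; apply/orP; right.
rewrite [store _]/=; have := potential_le G; move: (potential G) (#|` nodes G|) n0; lia.
Qed.
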